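(* Let $A\in \mathrm{GL}_2(\mathbb R)$ and $\mathbb T^2_A=\mathbb R^2/(A\mathbb Z^2)$. For every $\lambda>0$ and every function $u\in L^2(\mathbb T^2_A)$ such that $\operatorname{supp}\widehat u\subset\mathcal S_\lambda(A)$, $$\|u\|_{L^4(\mathbb T^2_A)}^4\le\frac{3}{|\det A|}\,\|u\|_{L^2(\mathbb T^2_A)}^4 .$$ Moreover, the constant $3$ is sharp when $A=I_2$, in the sense that there exist a sequence $(\lambda_n)_n$ of positive integers and a sequence $(u_n)_n$ in $L^2(\mathbb T^2)$, where $\mathbb T^2=\mathbb R^2/\mathbb Z^2$, such that $$\operatorname{supp}\widehat{u_n}\subset\mathcal S_{\lambda_n},\qquad \|u_n\|_{L^2(\mathbb T^2)}^4=1,\qquad \|u_n\|_{L^4(\mathbb T^2)}^4\underset{n\to+\infty}{\longrightarrow}3 .$$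
   Context: Set $\mathbb Z^2_A=(A^{-1})^*\mathbb Z^2$, where $^*$ denotes the transpose. For $\lambda>0$, $\mathcal S_\lambda(A)=\{m\in\mathbb Z^2_A: |m|^2=\lambda\}$ ($|\cdot|$ the Euclidean norm), and $\mathcal S_\lambda=\mathcal S_\lambda(I_2)=\{m\in\mathbb Z^2:|m|^2=\lambda\}$. The functions $e_m(x)=|\det A|^{-1/2}e^{2i\pi m\cdot x}$, $m\in\mathbb Z^2_A$, form an orthonormal basis of $L^2(\mathbb T^2_A)$ (with Lebesgue measure on a fundamental domain), and $\widehat u=(\langle u,e_m\rangle)_{m\in\mathbb Z^2_A}$ denotes the family of Fourier coefficients of $u$; its support is the set of $m\in\mathbb Z^2_A$ at which it is non-zero. *)

(* Defs.v *)
From HB Require Import structures.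
From mathcomp Require Import all_boot all_order all_algebra.
From mathcomp Require Import all_classical all_reals all_analysis.
From mathcomp Require Import complex.

Set Implicit Arguments.
Unset Strict Implicit.
Unset Printing Implicit Defensive.

Import Order.TTheory GRing.Theory Num.Theory.
Import numFieldNormedType.Exports.

Local Open Scope classical_set_scope.
Local Open Scope ring_scope.

Section Plane.
Context {R : realType}.

(* Vectors of the plane are pairs, so that the product measure applies. *)
Definition mulmxv (A : 'M[R]_2) (x : R * R) : R * R :=
  (A 0 0 * x.1 + A 0 1 * x.2, A 1 0 * x.1 + A 1 1 * x.2).

Definition dotv (x y : R * R) : R := x.1 * y.1 + x.2 * y.2.

(* The library norm on R * R is the sup norm. *)
Definition enorm (x : R * R) : R := Num.sqrt (x.1 ^+ 2 + x.2 ^+ 2).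

Definition lebesgue_measure2 :
    {measure set (measurableTypeR R * measurableTypeR R) -> \bar R} :=
  (@lebesgue_measure R \x @lebesgue_measure R)%E.

Definition lattice (A : 'M[R]_2) : set (R * R) :=
  [set mulmxv A (k.1%:~R, k.2%:~R) | k in [set: int * int]].

Definition dual_lattice (A : 'M[R]_2) : set (R * R) := lattice (invmx A)^T.

Definition circle (A : 'M[R]_2) (lambda : R) : set (R * R) :=
  [set m | dual_lattice A m /\ enorm m ^+ 2 = lambda].

Definition fundamental_domain (A : 'M[R]_2) : set (R * R) :=
  [set mulmxv A t | t in `[0, 1[%classic `*` `[0, 1[%classic].

End Plane.

Section Torus.
Context {R : realType}.
Implicit Types (A : 'M[R]_2) (u : R * R -> R[i]).

Definition periodic A u : Prop :=
  forall x g, lattice A g -> u (x + g) = u x.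

(* The L^p norm over the torus, possibly infinite. *)
Definition torus_norm A (p : R) u : \bar R :=
  Lnorm lebesgue_measure2 p%:E
    ((fun x => (ComplexField.Normc.normc (u x))%:E) \_ (fundamental_domain A)).

(* An L^2 class on the torus is given by a representative, seen as an
   A Z^2-periodic Borel function on the plane; norms and Fourier coefficients
   do not depend on the representative. *)
Definition L2_torus A u : Prop :=
  [/\ periodic A u,
      measurable_fun [set: measurableTypeR R * measurableTypeR R]
        (fun x => complex.Re (u x)),
      measurable_fun [set: measurableTypeR R * measurableTypeR R]
        (fun x => complex.Im (u x)) &
      (torus_norm A 2 u < +oo)%E].

Definition expi (t : R) : R[i] := Complex (cos t) (sin t).

Definition fourier_basis A (m x : R * R) : R[i] :=
  ((Num.sqrt `|\det A|)^-1)%:C%C * expi (2 * pi * dotv m x).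

Definition cintegral (D : set (R * R)) (f : R * R -> R[i]) : R[i] :=
  Complex (\int[lebesgue_measure2]_(x in D) complex.Re (f x))
          (\int[lebesgue_measure2]_(x in D) complex.Im (f x)).

Definition fourier_coef A u (m : R * R) : R[i] :=
  cintegral (fundamental_domain A)
    (fun x => u x * conjc (fourier_basis A m x)).

Definition fourier_supp A u : set (R * R) :=
  [set m | dual_lattice A m /\ fourier_coef A u m != 0].

End Torus.

(* Main.v *)
Require Import Defs.
From HB Require Import structures.
From mathcomp Require Import all_boot all_order all_algebra.
From mathcomp Require Import all_classical all_reals all_analysis.
From mathcomp Require Import complex.
From mathcomp Require Import measurable_realfun ring lra zify.
Import Order.TTheory GRing.Theory Num.Theory.
Import numFieldNormedType.Exports.
Local Open Scope classical_set_scope.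
Local Open Scope ring_scope.

Set Implicit Arguments.
Unset Strict Implicit.
Unset Printing Implicit Defensive.


(** Let u have its frequencies on a circle centered at 0.  If u is the
    trigonometric sum of the c_m e_m, expanding |u|^4 and integrating keeps the
    quadruples of frequencies with a + b = c + d.  The points a, c, b, d are then
    the vertices of a parallelogram inscribed in a circle, that is of a
    rectangle, possibly degenerate: either (c, d) = (a, b), or (c, d) = (b, a),
    or b = - a and d = - c ([circle_trivial_sums]).  Each of these three families
    contributes at most the square of the sum of the |c_m|^2, the last one by
    the arithmetic-geometric mean inequality; whence the constant 3
    ([energy_le]).  If the coefficients are equal on a set of N frequencies that
    is stable under opposite, the three families have N^2 members each and
    overlap in at most 3 N quadruples, so that the ratio is at least 3 - 3 / N
    ([energy1_ge]).  Circles with arbitrarily many lattice points come from the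
    rational parametrization of the unit circle ([many_lattice_points]).

    The analytic content is that a function of L^2 whose coefficients vanish
    outside of a finite set is almost everywhere a trigonometric sum, in other
    words that an integrable function g on the unit square which is orthogonal
    to all characters is zero almost everywhere ([fourier_uniqueness]).  For
    this, consider the bounded functions phi such that g phi is still orthogonal
    to all characters.  They are stable under linear combinations, under
    products with characters and, by dominated convergence, under bounded
    pointwise limits.  If p = alpha + beta cos (2 pi k.t + theta) takes its values
    in [0, 1], then (1 - p^n)^(n 2^n) tends to the indicator of p < 1/2
    ([cvg_threshold]), so this class is stable under multiplication by that
    indicator.  The sets whose indicators preserve the class form a
    sigma-algebra; it contains the half-planes parallel to the axes, up to
    points outside of the square, hence all the Borel sets E, and
    the integral of g over E vanishes.

    A linear change of variables, which multiplies areas by |det A|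
    ([scales_area_linear]), brings the torus of A to the unit square, and the
    dual lattice to the integer frequencies ([fourier_coef_transport]). *)

(** * Linear changes of variables in the plane *)

Section PushforwardMeasure.
Context d d' (T1 : measurableType d) (T2 : measurableType d') (R : realType).

(** Carries the proof of measurability that makes the image a measure, since
    unification cannot infer it. *)
Definition pushforward_measure (m : {measure set T1 -> \bar R}) (f : T1 -> T2)
  (mf : measurable_fun [set: T1] f) : {measure set T2 -> \bar R}.
Proof. by refine (pushforward m f); exact: mf. Defined.

End PushforwardMeasure.
Arguments pushforward_measure {d d' T1 T2 R} m {f} mf.

Section ChangeOfVariables.
Context {R : realType}.
Local Notation line := (measurableTypeR R).
Local Notation plane := (measurableTypeR R * measurableTypeR R)%type.
Local Notation lam := (@lebesgue_measure R).
Local Notation lam2 := (@lebesgue_measure2 R).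

Lemma lebesgue_translate (a : R) (F : set line) :
  measurable F -> lam ((fun y => y + a) @^-1` F) = lam F.
Proof.
move=> mF.
have mf : measurable_fun [set: line] ((fun y => y + a) : line -> line).
  exact: measurable_funD.
rewrite [RHS](@lebesgue_measure_unique _ (pushforward_measure lam mf))//.
move=> _ [[p q] _ <-] /=; rewrite /pushforward.
rewrite (_ : _ @^-1` _ = `]p - a, q - a]%classic); last first.
  by apply/seteqP; split => x /=; rewrite !in_itv/=; lra.
rewrite !lebesgue_measure_itv/= !lte_fin ltrD2r.
by case: ifPn => // _; rewrite -!EFinD; congr EFin; ring.
Qed.

Lemma lebesgue_dilate (a : R) (F : set line) : a != 0 ->
  measurable F -> (`|a|%:E * lam ((fun y => (a * y)%R) @^-1` F) = lam F)%E.
Proof.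
move=> a0 mF.
have mf : measurable_fun [set: line] ((fun y => a * y) : line -> line).
  exact: measurable_funM.
rewrite [RHS](@lebesgue_measure_unique _
  (mscale `|a|%:nng (pushforward_measure lam mf)))//.
move=> _ [[p q] _ <-] /=; rewrite /mscale /= /pushforward.
have := a0; rewrite neq_lt => /orP[an|ap].
  (* A negative factor moves the closed end of the interval to the left. *)
  rewrite (_ : _ @^-1` _ = `[q / a, p / a[%classic); last first.
    apply/seteqP; split => x /=; rewrite !in_itv/= ltr_ndivlMr// ler_ndivrMr//;
    by rewrite andbC mulrC.
  rewrite !lebesgue_measure_itv/= !lte_fin ltr_nM2r ?invr_lt0//.
  case: ifPn => [_|]; last by rewrite mule0.
  rewrite ltr0_norm// -!EFinD -EFinM; congr EFin; field; lra.
rewrite (_ : _ @^-1` _ = `]p / a, q / a]%classic); last first.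
  apply/seteqP; split => x /=; rewrite !in_itv/= ltr_pdivrMr// ler_pdivlMr//;
  by rewrite mulrC.
rewrite !lebesgue_measure_itv/= !lte_fin ltr_pM2r ?invr_gt0//.
case: ifPn => [_|]; last by rewrite mule0.
rewrite gtr0_norm// -!EFinD -EFinM; congr EFin; field; lra.
Qed.

(** Formulated with preimages: this composes, and it says that c times the image
    of the Lebesgue measure under f is the Lebesgue measure. *)
Definition scales_area (f : plane -> plane) (c : R) : Prop :=
  measurable_fun [set: plane] f /\
  forall E : set plane, measurable E -> (c%:E * lam2 (f @^-1` E) = lam2 E)%E.

Lemma scales_area_comp f g c e : scales_area f c -> scales_area g e ->
  scales_area (f \o g) (c * e).
Proof.
move=> [mf fE] [mg gE]; split; first exact: measurableT_comp.
move=> E mE; rewrite comp_preimage EFinM -muleA gE ?fE//.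
by rewrite -[X in measurable X]setTI; exact: mf.
Qed.

(** By Tonelli's theorem a map that preserves every vertical line can be examined
    line by line; shears and dilations along an axis are of this kind. *)
Lemma scales_area_vertical (g : R -> R -> R) (c : R) : 0 <= c ->
  measurable_fun [set: plane] (fun z : plane => (z.1, g z.1 z.2) : plane) ->
  (forall x (F : set line), measurable F ->
     c%:E * lam (g x @^-1` F) = lam F)%E ->
  scales_area (fun z => (z.1, g z.1 z.2)) c.
Proof.
move=> c0 mf gE; split=> // E mE.
rewrite /lebesgue_measure2 /product_measure1.
rewrite -ge0_integralZl//.
- apply: eq_integral => x _ /=.
  rewrite -(gE x _ (measurable_xsection x mE)).
  by rewrite !xsectionE.
- apply: measurable_fun_xsection.
  by rewrite -[X in measurable X]setTI; exact: mf.
Qed.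

Lemma scales_area_swap : scales_area (fun z => (z.2, z.1)) 1.
Proof.
have mf : measurable_fun [set: plane] ((fun z => (z.2, z.1)) : plane -> plane).
  exact: measurable_fun_pair.
split=> // E mE; rewrite mul1e.
rewrite [RHS](@product_measure_unique _ _ _ _ _ lam lam
  (pushforward_measure lam2 mf))//.
move=> A B mA mB.
rewrite /= /pushforward (_ : _ @^-1` _ = B `*` A); last first.
  by apply/seteqP; split => -[x y] /= [].
by rewrite muleC; exact: product_measure1E.
Qed.

(** Gaussian elimination: if the pivot a is not 0, the map is a product of shears,
    dilations and swaps of the axes, each of which scales areas; otherwise
    exchanging the rows makes c the pivot. *)
Lemma scales_area_linear (a b c d : R) : a * d - b * c != 0 ->
  scales_area (fun z => (a * z.1 + b * z.2, c * z.1 + d * z.2))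
    `|a * d - b * c|.
Proof.
pose shear t (z : plane) : plane := (z.1, z.2 + t * z.1).
pose dil t (z : plane) : plane := (z.1, t * z.2).
pose swap (z : plane) : plane := (z.2, z.1).
have Pshear t : scales_area (shear t) 1.
  apply: (@scales_area_vertical (fun x y => y + t * x)) => //.
    apply: measurable_fun_pair => //.
    by apply: measurable_funD => //; exact: measurable_funM.
  move=> x F mF; rewrite mul1e; exact: lebesgue_translate.
have Pdil t : t != 0 -> scales_area (dil t) `|t|.
  move=> t0.
  apply: (@scales_area_vertical (fun x y => t * y)) => //.
    apply: measurable_fun_pair => //.
    exact: measurable_funM.
  move=> x F mF; exact: lebesgue_dilate.
have Pswap : scales_area swap 1 by exact: scales_area_swap.
have main (a' b' c' d' : R) : a' != 0 -> a' * d' - b' * c' != 0 ->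
    scales_area (fun z => (a' * z.1 + b' * z.2, c' * z.1 + d' * z.2))
    `|a' * d' - b' * c'|.
  (* The pivots are a' and e. *)
  move=> a0 D0; set e := d' - b' * c' / a'.
  have De : a' * d' - b' * c' = a' * e by rewrite /e; field.
  have e0 : e != 0 by move: D0; rewrite De mulf_eq0 negb_or a0.
  have -> : `|a' * d' - b' * c'| = 1 * (`|e| * (1 * (1 * (`|a'| * 1)))).
    by rewrite De normrM; ring.
  rewrite (_ : (fun _ => _) = shear (c' / a') \o (dil e \o (swap \o
     (shear b' \o (dil a' \o swap))))).
    do !apply: scales_area_comp => //; try exact: Pdil.
  apply/funext => -[x y]; rewrite /shear /dil /swap /=; congr pair.
  by rewrite /e; field.
move=> D0; have [a0|] := eqVneq a 0; last by move=> /main /(_ D0).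
have c0 : c != 0 by apply: contraNneq D0 => ->; rewrite a0; apply/eqP; ring.
have D' : c * b - d * a != 0 by move: D0; rewrite a0; apply: contraNneq => h; apply/eqP; lra.
have := scales_area_comp Pswap (main c d a b c0 D').
rewrite mul1r (_ : `|_| = `|a * d - b * c|) // -normrN; congr `|_|; ring.
Qed.

Lemma ge0_integral_scales_area (f : plane -> plane) c (E : set plane)
    (F : plane -> \bar R) :
  0 <= c -> scales_area f c -> measurable E -> measurable_fun [set: plane] F ->
  (forall x, 0 <= F x)%E ->
  (\int[lam2]_(x in E) F x = c%:E * \int[lam2]_(x in f @^-1` E) F (f x))%E.
Proof.
move=> c0 [mf fE] mE mF F0.
rewrite (@eq_measure_integral _ _ _ _
   (mscale (NngNum c0) (pushforward_measure lam2 mf))); last first.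
  by move=> B mB _; rewrite -[LHS]fE.
rewrite (ge0_integral_mscale _ mE _ (measurable_funTS mF) (fun x _ => F0 x)).
have := ge0_integral_pushforward mf lam2 mE (measurable_funTS mF) (fun x _ => F0 x).
by move=> /= <-.
Qed.

Lemma Rintegral_scales_area (f : plane -> plane) c (E : set plane)
    (F : plane -> R) :
  0 <= c -> scales_area f c -> measurable E -> measurable_fun [set: plane] F ->
  lam2.-integrable (f @^-1` E) (EFin \o (F \o f)) ->
  \int[lam2]_(x in E) F x = c * \int[lam2]_(x in f @^-1` E) F (f x).
Proof.
move=> c0 fc mE mF intF.
have mD : measurable (f @^-1` E).
  by rewrite -[X in measurable X]setTI; exact: fc.1.
have mF' : measurable_fun [set: plane] (EFin \o F) by exact/measurable_EFinP.
rewrite /Rintegral [X in fine X = _]integralE [X in _ = _ * fine X]integralE.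
rewrite (ge0_integral_scales_area c0 fc mE (measurable_funepos mF') (funepos_ge0 _)).
rewrite (ge0_integral_scales_area c0 fc mE (measurable_funeneg mF') (funeneg_ge0 _)).
have p1 := integrable_pos_fin_num mD intF.
have p2 := integrable_neg_fin_num mD intF.
rewrite (_ : (fun x => (EFin \o F)^\+ (f x))%E = ((EFin \o (F \o f))^\+)%E); last first.
  by apply/funext=> x; rewrite !funeposE.
rewrite (_ : (fun x => (EFin \o F)^\- (f x))%E = ((EFin \o (F \o f))^\-)%E); last first.
  by apply/funext=> x; rewrite !funenegE.
rewrite (_ : (fun x => (F (f x))%:E)%E = (EFin \o (F \o f))%E)//.
by rewrite -(fineK p1) -(fineK p2) -!EFinM -!EFinB /= mulrBr.
Qed.

End ChangeOfVariables.

(** * Waves on the unit square *)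

Section Characters.
Context {R : realType}.
Local Notation line := (measurableTypeR R).
Local Notation plane := (measurableTypeR R * measurableTypeR R)%type.
Local Notation lam := (@lebesgue_measure R).
Local Notation lam2 := (@lebesgue_measure2 R).

Definition unit_square : set (R * R) := `[0, 1[%classic `*` `[0, 1[%classic.
Local Notation D := unit_square.

Lemma measurable_unit_square : measurable (D : set plane).
Proof. exact: measurableX. Qed.

Lemma unit_square_measure : lam2 D = 1%E.
Proof.
have lI : lam `[0, 1[%classic = 1%E.
  by rewrite lebesgue_measure_itv/= lte_fin ltr01 -EFinD subr0.
by rewrite [LHS]product_measure1E// -[RHS]mul1e; congr (_ * _)%E; exact: lI.
Qed.

Lemma bounded_integrable_square (f : plane -> R) C :
  measurable_fun [set: plane] f -> (forall x, `|f x| <= C) ->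
  lam2.-integrable D (EFin \o f).
Proof.
move=> mf fC; apply: measurable_bounded_integrable.
- exact: measurable_unit_square.
- by rewrite [ltLHS]unit_square_measure ltry.
- exact: measurable_funTS.
- exists C; split; first exact: num_real.
  by move=> M CM x _; apply: le_trans (fC x) (ltW CM).
Qed.

Definition freq (k : int * int) : R * R := (k.1%:~R, k.2%:~R).

Lemma freqD k l : freq (k + l) = freq k + freq l.
Proof. by rewrite /freq /= !intrD. Qed.

Lemma freqN k : freq (- k) = - freq k.
Proof. by rewrite /freq /= !intrN. Qed.

Lemma dotvDl (x y z : R * R) : dotv (x + y) z = dotv x z + dotv y z.
Proof. by rewrite /dotv /=; ring. Qed.

Lemma dotvNl (x z : R * R) : dotv (- x) z = - dotv x z.
Proof. by rewrite /dotv /=; ring. Qed.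

(** The phase treats sines and cosines alike, and makes a product of two waves a
    combination of two waves. *)
Definition wave (k : int * int) (th : R) (t : R * R) : R :=
  cos (2 * pi * dotv (freq k) t + th).

Lemma measurable_cosT : measurable_fun [set: line] (@cos R : line -> line).
Proof. by apply: continuous_measurable_fun; exact: continuous_cos. Qed.

Lemma measurable_wave k th : measurable_fun [set: plane] (wave k th : plane -> R).
Proof.
apply: (measurableT_comp measurable_cosT).
apply: measurable_funD => //; apply: measurable_funM => //.
by apply: measurable_funD; exact: measurable_funM.
Qed.

Lemma wave_le1 k th t : `|wave k th t| <= 1.
Proof. by rewrite ler_norml cos_geN1 cos_le1. Qed.

Lemma waveM k th l ph t : wave k th t * wave l ph t =
  2^-1 * wave (k + l) (th + ph) t + 2^-1 * wave (k - l) (th - ph) t.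
Proof.
rewrite /wave freqD freqD freqN !dotvDl dotvNl.
set a := 2 * pi * dotv (freq k) t; set b := 2 * pi * dotv (freq l) t.
have -> : 2 * pi * (dotv (freq k) t + dotv (freq l) t) + (th + ph) = (a + th) + (b + ph).
  by rewrite /a /b; ring.
have -> : 2 * pi * (dotv (freq k) t + - dotv (freq l) t) + (th - ph) = (a + th) - (b + ph).
  by rewrite /a /b; ring.
by move: (a + th) (b + ph) => A B; rewrite cosD cosB; field.
Qed.

Lemma cosD2pin (x : R) (n : int) : cos (x + 2 * pi * n%:~R) = cos x.
Proof.
have natcase (y : R) m : cos (y + 2 * pi * m%:R) = cos y.
  have -> : 2 * pi * m%:R = pi *+ 2 *+ m :> R.
    by rewrite -[RHS]mulr_natr -[pi *+ 2]mulr_natl.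
  exact: periodicn (@cosD2pi R) m y.
case: n => m; first exact: natcase.
rewrite NegzE -[LHS](natcase _ m.+1); congr cos.
by rewrite intrN -pmulrn; ring.
Qed.

Lemma sinD2pin (x : R) (n : int) : sin (x + 2 * pi * n%:~R) = sin x.
Proof. by rewrite -!cosBpihalf addrAC cosD2pin. Qed.

Lemma integral_wave1 (n : int) (c : R) : n != 0 ->
  (\int[lam]_(x in `[0%R, 1%R[) (cos (2 * pi * n%:~R * x + c))%:E = 0)%E.
Proof.
move=> n0.
have w0 : 2 * pi * n%:~R != 0 :> R.
  by rewrite !mulf_neq0 ?intr_eq0// gt_eqF// pi_gt0.
set w := 2 * pi * n%:~R in w0 *.
have ca : continuous (fun x : R => cos (w * x + c)).
  move=> x; apply: continuous_comp; last exact: continuous_cos.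
  apply: cvgD; last exact: cvg_cst.
  by apply: cvgM; [exact: cvg_cst|exact: cvg_id].
have dF (x : R) : is_derive x 1 (fun x : R => w^-1 * sin (w * x + c)) (cos (w * x + c)).
  have dl : is_derive x 1 (w \*: (@idfun R : R -> R) + cst c : R -> R) (w *: (1 : R) + 0).
    exact: is_deriveD.
  have ds := @is_derive1_comp R sin _ x _ _ (is_derive_sin (w * x + c)) dl.
  apply: (is_derive_eq (is_deriveZ w^-1 ds)).
  by rewrite /GRing.scale/= mulr1 addr0; field.
rewrite integral_itv_bndo_bndc; last first.
  apply: measurable_funTS; apply/measurable_EFinP.
  exact: continuous_measurable_fun.
rewrite (@continuous_FTC2 _ _ (fun x : R => w^-1 * sin (w * x + c)))//.
- have h : sin (w + c) = sin c by rewrite addrC; exact: sinD2pin.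
  by rewrite mulr1 mulr0 add0r h -EFinB subrr.
- exact: continuous_subspaceT.
- have cF : continuous (fun x : R => w^-1 * sin (w * x + c)).
    move=> x; apply: differentiable_continuous; apply/derivable1_diffP.
    by have [] := dF x.
  split.
  + by move=> x _; have [] := dF x.
  + by apply: cvg_at_right_filter; exact: cF.
  + by apply: cvg_at_left_filter; exact: cF.
- by move=> x _; rewrite derive1E; have [_ ->] := dF x.
Qed.

Lemma patch_square (f : plane -> R) x y :
  ((EFin \o f) \_ D) (x, y) =
   (if x \in `[0%R, 1%R[ then ((fun y => (f (x, y))%:E) \_ `[0%R, 1%R[%classic) y else 0)%E.
Proof.
rewrite !patchE /D in_setX /= !mem_setE.
by case: (x \in _) => //=.
Qed.

(** If a component of k is not 0, the integral along the corresponding axis is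
    already 0, being that of a cosine over full periods. *)
Lemma integral_wave k th :
  \int[lam2]_(t in D) wave k th t = if k == 0 then cos th else 0.
Proof.
case: k => k1 k2.
have iw := bounded_integrable_square (measurable_wave (k1, k2) th) (wave_le1 (k1, k2) th).
have iwT : lam2.-integrable setT ((EFin \o wave (k1, k2) th) \_ D).
  exact/(integrable_mkcond _ measurable_unit_square).
case: ifPn => [/eqP[-> ->]|k0].
  rewrite (@eq_Rintegral _ _ _ _ _ (cst (cos th))); last first.
    by move=> t _; rewrite /wave /dotv /= !mul0r addr0 mulr0 add0r.
  rewrite Rintegral_cst; last exact: measurable_unit_square.
  by rewrite unit_square_measure /= mulr1.
rewrite /Rintegral integral_mkcond.
have [k20|k20] := eqVneq k2 0.
  have k10 : k1 != 0 by apply: contraNneq k0 => ->; rewrite k20.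
  rewrite -(integral21_prod_meas1 iwT) integral0_eq // => y _.
  rewrite /fubini_G.
  have [yI|yI] := boolP (y \in `[0, 1[).
    rewrite (_ : (fun _ => _) = ((fun x => (wave (k1, k2) th (x, y))%:E) \_ `[0, 1[%classic)).
      rewrite -integral_mkcond -[RHS](integral_wave1 th k10).
      apply: eq_integral => x _; congr (cos _)%:E.
      by rewrite /dotv/= k20; ring.
    apply/funext => x; rewrite !patchE /D in_setX /= !mem_setE yI andbT //.
  apply: integral0_eq => x _.
  by rewrite !patchE /D in_setX /= !mem_setE (negbTE yI) andbF.
rewrite -(integral12_prod_meas1 iwT) integral0_eq // => x _.
rewrite /fubini_F.
have [xI|xI] := boolP (x \in `[0, 1[).
  rewrite (_ : (fun _ => _) = ((fun y => (wave (k1, k2) th (x, y))%:E) \_ `[0, 1[%classic)).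
    rewrite -integral_mkcond -[RHS](integral_wave1 (2 * pi * k1%:~R * x + th) k20).
    apply: eq_integral => y _; congr (cos _)%:E.
    by rewrite /dotv/=; ring.
  by apply/funext => y; rewrite patch_square xI.
apply: integral0_eq => y _.
by rewrite patch_square (negbTE xI).
Qed.

End Characters.

(** * Indicators as limits of powers *)

Section ThresholdPowers.
Context {R : realType}.

Lemma bernoulli_ge (x : R) n : 0 <= 1 + x -> 1 + n%:R * x <= (1 + x) ^+ n.
Proof.
move=> x0; case: n => [|n]; first by rewrite mul0r addr0 expr0.
elim: n => [|n IH]; first by rewrite mul1r expr1.
rewrite exprS; apply: le_trans (ler_wpM2l x0 IH).
have : 0 <= n%:R * x ^+ 2 :> R by rewrite mulr_ge0// sqr_ge0.
rewrite -!natr1; nra.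
Qed.

(** With z the square root of y, Bernoulli's inequality bounds n z^n, and the
    remaining factor z^n tends to 0. *)
Lemma cvg_natr_exp (y : R) : 0 <= y < 1 -> (fun n => n%:R * y ^+ n) @ \oo --> (0 : R).
Proof.
move=> /andP[y0 y1].
have [->|yN0] := eqVneq y 0.
  apply: cvg_near_cst; apply: nearW => -[|n]; first by rewrite mul0r.
  by rewrite exprS mul0r mulr0.
have yp : 0 < y by rewrite lt_neqAle eq_sym yN0.
set z := Num.sqrt y.
have zp : 0 < z by rewrite sqrtr_gt0.
have z2 : z ^+ 2 = y by rewrite sqr_sqrtr.
have z1 : z < 1 by rewrite -sqrtr1 ltr_sqrt.
have zV : 0 < z^-1 - 1 by rewrite subr_gt0 invf_gt1.
have bnd n : n%:R * z ^+ n <= (z^-1 - 1)^-1.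
  have := @bernoulli_ge (z^-1 - 1) n.
  rewrite addrC subrK invr_ge0 (ltW zp) => /(_ isT) H.
  rewrite -[leRHS]mul1r ler_pdivlMr// mulrAC.
  have one : z^-1 ^+ n * z ^+ n = 1 by rewrite -exprMn mulVf ?expr1n// gt_eqF.
  rewrite -[leRHS]one ler_wpM2r ?exprn_ge0 ?(ltW zp)//; apply: le_trans H.
  by rewrite lerDr.
apply: (@squeeze_cvgr _ _ _ _ (fun=> 0) (fun n => (z^-1 - 1)^-1 * z ^+ n)).
- apply: nearW => n; rewrite mulr_ge0 ?exprn_ge0//=.
  rewrite -z2 expr2 exprMn mulrA ler_wpM2r ?bnd// exprn_ge0// ltW//.
- exact: cvg_cst.
- rewrite -[X in _ --> X](mulr0 (z^-1 - 1)^-1); apply: cvgM; first exact: cvg_cst.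
  by apply: cvg_expr; rewrite gtr0_norm.
Qed.

(** By Bernoulli's inequality, (1 - p^n)^(n 2^n) is at least 1 - n (2p)^n, and at
    most 1 / (1 + p^n)^(n 2^n), hence at most 1 / (1 + n (2p)^n).  The factor n in
    the exponent makes the limit 0 also at p = 1/2. *)
Lemma cvg_threshold (p : R) : 0 <= p <= 1 ->
  (fun n => (1 - p ^+ n) ^+ (n * 2 ^ n)) @ \oo --> ((p < 2^-1)%R%:R : R).
Proof.
move=> /andP[p0 p1].
have pn0 n : 0 <= p ^+ n by rewrite exprn_ge0.
have pn1 n : p ^+ n <= 1 by rewrite exprn_ile1.
have q0 n : 0 <= 1 - p ^+ n by rewrite subr_ge0.
have nE n : (n * 2 ^ n)%:R * p ^+ n = n%:R * (2 * p) ^+ n.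
  by rewrite natrM natrX exprMn mulrA.
have [ph|ph] := ltP p 2^-1.
  apply: (@squeeze_cvgr _ _ _ _ (fun n => 1 - n%:R * (2 * p) ^+ n) (fun=> 1)).
  - apply: nearW => n; apply/andP; split.
      by rewrite -nE -mulrN; apply: bernoulli_ge.
    by rewrite exprn_ile1// lerBlDr lerDl.
  - rewrite -[X in _ --> X]subr0; apply: cvgB; first exact: cvg_cst.
    by apply: cvg_natr_exp; apply/andP; split; lra.
  - exact: cvg_cst.
apply: (@squeeze_cvgr _ _ _ _ (fun=> 0) (@harmonic R)).
- apply: nearW => n; rewrite exprn_ge0//=.
  have le1 : (1 - p ^+ n) ^+ (n * 2 ^ n) * (1 + p ^+ n) ^+ (n * 2 ^ n) <= 1.
    rewrite -exprMn exprn_ile1//.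
      by rewrite mulr_ge0// addr_ge0.
    have := sqr_ge0 (p ^+ n); nra.
  have ge : n.+1%:R <= (1 + p ^+ n) ^+ (n * 2 ^ n).
    apply: le_trans (bernoulli_ge _ _); last by rewrite addr_ge0.
    rewrite nE -natr1 addrC lerD2l ler_peMr// exprn_ege1//; lra.
  have [n1 n2] : 0 < n.+1%:R :> R /\ 0 < (1 + p ^+ n) ^+ (n * 2 ^ n).
    by split => //; apply: lt_le_trans ge.
  rewrite /harmonic /= -[leRHS]mul1r ler_pdivlMr//; apply: le_trans le1.
  by rewrite ler_wpM2l// exprn_ge0.
- exact: cvg_cst.
- exact: cvg_harmonic.
Qed.

End ThresholdPowers.

(** * Uniqueness of Fourier coefficients *)

Section Uniqueness.
Context {R : realType}.
Local Notation line := (measurableTypeR R).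
Local Notation plane := (measurableTypeR R * measurableTypeR R)%type.
Local Notation lam2 := (@lebesgue_measure2 R).
Local Notation D := (@unit_square R).
Variable g : plane -> R.
Hypothesis ig : lam2.-integrable D (EFin \o g).

Let mD : measurable (D : set plane). Proof. exact: measurable_unit_square. Qed.

Definition bounded_measurable (phi : plane -> R) :=
  measurable_fun [set: plane] phi /\ exists C, forall t, `|phi t| <= C.

Lemma integrable_mul_bounded phi : bounded_measurable phi ->
  lam2.-integrable D (EFin \o (fun t => g t * phi t)).
Proof.
move=> [mphi [C phiC]].
apply: (@integrableMl _ _ _ lam2 D mD (EFin \o g) phi ig).
  exact: measurable_funTS.
exists C; split; first exact: num_real.
by move=> M CM x _; apply: le_trans (phiC x) (ltW CM).
Qed.

(** Orthogonality to every wave, and not only to 1, is what makes this class of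
    multipliers stable under multiplication by waves. *)
Definition wave_orthogonal (phi : plane -> R) :=
  bounded_measurable phi /\
  forall k th, \int[lam2]_(t in D) (g t * (phi t * wave k th t)) = 0.

Lemma bounded_measurable_lin a b phi psi : bounded_measurable phi ->
  bounded_measurable psi -> bounded_measurable (fun t => a * phi t + b * psi t).
Proof.
move=> [mphi [C phiC]] [mpsi [C' psiC]]; split.
  by apply: measurable_funD; apply: measurable_funM.
exists (`|a| * C + `|b| * C') => t; apply: le_trans (ler_normD _ _) _.
by rewrite !normrM lerD// ler_wpM2l.
Qed.

Lemma bounded_measurableM phi psi : bounded_measurable phi ->
  bounded_measurable psi -> bounded_measurable (fun t => phi t * psi t).
Proof.
move=> [mphi [C phiC]] [mpsi [C' psiC]]; split; first exact: measurable_funM.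
by exists (C * C') => t; rewrite normrM ler_pM.
Qed.

Lemma bounded_measurable_wave k th : bounded_measurable (wave k th).
Proof. by split; [exact: measurable_wave|exists 1 => t; exact: wave_le1]. Qed.

Lemma wave_orthogonal_lin a b phi psi :
  wave_orthogonal phi -> wave_orthogonal psi ->
  wave_orthogonal (fun t => a * phi t + b * psi t).
Proof.
move=> [bphi ophi] [bpsi opsi]; split; first exact: bounded_measurable_lin.
move=> k th.
have i1 := integrable_mul_bounded (bounded_measurableM bphi (bounded_measurable_wave k th)).
have i2 := integrable_mul_bounded (bounded_measurableM bpsi (bounded_measurable_wave k th)).
rewrite (@eq_Rintegral _ _ _ _ _ (fun t => a * (g t * (phi t * wave k th t)) +
   b * (g t * (psi t * wave k th t)))); last by move=> t _; ring.
rewrite RintegralD//; [|exact: (integrableZl mD a i1)|exact: (integrableZl mD b i2)].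
by rewrite !RintegralZl// ophi opsi !mulr0 addr0.
Qed.

Lemma wave_orthogonal_eq phi psi : bounded_measurable psi ->
  (forall t, D t -> phi t = psi t) -> wave_orthogonal phi -> wave_orthogonal psi.
Proof.
move=> bpsi e [_ ophi]; split=> // k th; rewrite -[RHS](ophi k th).
by apply: eq_Rintegral => t; rewrite inE => /e ->.
Qed.

Lemma wave_orthogonal_wave phi k th : wave_orthogonal phi ->
  wave_orthogonal (fun t => phi t * wave k th t).
Proof.
move=> [bphi ophi]; split.
  exact: bounded_measurableM bphi (bounded_measurable_wave _ _).
move=> l ph.
rewrite (@eq_Rintegral _ _ _ _ _ (fun t => 2^-1 * (g t * (phi t * wave (k + l) (th + ph) t)) +
   2^-1 * (g t * (phi t * wave (k - l) (th - ph) t)))); last first.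
  by move=> t _; rewrite -[in LHS]mulrA waveM; ring.
have i1 := integrable_mul_bounded
  (bounded_measurableM bphi (bounded_measurable_wave (k + l) (th + ph))).
have i2 := integrable_mul_bounded
  (bounded_measurableM bphi (bounded_measurable_wave (k - l) (th - ph))).
rewrite RintegralD//; [|exact: (integrableZl mD _ i1)|exact: (integrableZl mD _ i2)].
by rewrite !RintegralZl// !ophi !mulr0 addr0.
Qed.

(** Dominated convergence with the bound C |g|. *)
Lemma wave_orthogonal_lim (phi_ : nat -> plane -> R) phi C :
  (forall n, wave_orthogonal (phi_ n)) -> (forall n t, `|phi_ n t| <= C) ->
  (forall t, phi_ n t @[n --> \oo] --> phi t) -> wave_orthogonal phi.
Proof.
move=> op pC cp.
have mphi : measurable_fun [set: plane] phi.
  apply: (@measurable_fun_cvg _ _ _ _ phi_) => [n|t _]; last exact: cp.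
  by have [[]] := op n.
have phiC t : `|phi t| <= C.
  have cn : `|phi_ n t| @[n --> \oo] --> `|phi t| by apply: cvg_norm; exact: cp.
  rewrite -(cvg_lim (@Rhausdorff R) cn); apply: limr_le.
    by apply: cvgP cn.
  by apply: nearW => n; exact: pC.
have bphi : bounded_measurable phi by split=> //; exists C.
split=> // k th.
have in_ n := integrable_mul_bounded
  (bounded_measurableM (op n).1 (bounded_measurable_wave k th)).
have ilim := integrable_mul_bounded (bounded_measurableM bphi (bounded_measurable_wave k th)).
have [] := @dominated_convergence _ _ _ lam2 D mD
  (fun n t => (g t * (phi_ n t * wave k th t))%:E)
  (fun t => (g t * (phi t * wave k th t))%:E)
  (fun t => (C%:E * `|(g t)%:E|)%E).
- by move=> n; case/integrableP : (in_ n).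
- by case/integrableP : ilim.
- apply: aeW => t _; apply/fine_cvgP => /=; split.
    exact: nearW.
  apply: cvgM; first exact: cvg_cst.
  by apply: cvgM; [exact: cp|exact: cvg_cst].
- apply: (integrableZl mD); exact: integrable_abse.
- apply: aeW => t n _ /=; rewrite lee_fin !normrM mulrC ler_wpM2r//.
  rewrite -[leRHS]mulr1 ler_pM//. exact: wave_le1.
move=> _ _ /=.
rewrite (_ : (fun _ => _) = cst 0%E); last first.
  apply/funext => n /=.
  rewrite -[LHS]fineK; last exact: (integrable_fin_num mD (in_ n)).
  by congr EFin; exact: (op n).2.
move=> /(cvg_lim (@ereal_hausdorff R)) lim0.
by rewrite /Rintegral -lim0 lim_cst.
Qed.

Lemma wave_orthogonal_affine phi al be k th : wave_orthogonal phi ->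
  wave_orthogonal (fun t => phi t * (al + be * wave k th t)).
Proof.
move=> op; have := wave_orthogonal_lin al be op (wave_orthogonal_wave k th op).
by congr wave_orthogonal; apply/funext => t; ring.
Qed.

(** The class is stable under multiplication by an affine function of a wave, hence
    by polynomials in it; [cvg_threshold] gives the indicator in the limit. *)
Lemma wave_orthogonal_threshold phi al be k th :
  (forall t, 0 <= al + be * wave k th t <= 1) -> wave_orthogonal phi ->
  wave_orthogonal (fun t => phi t * (al + be * wave k th t < 2^-1)%R%:R).
Proof.
move=> p01; set p := fun t => al + be * wave k th t.
have Xp n psi : wave_orthogonal psi -> wave_orthogonal (fun t => psi t * p t ^+ n).
  move=> opsi; elim: n => [|n IH].
    by move: opsi; congr wave_orthogonal; apply/funext => t; rewrite expr0 mulr1.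
  have := wave_orthogonal_affine al be k th IH.
  by congr wave_orthogonal; apply/funext => t; rewrite exprSr mulrA.
have Xq n m psi : wave_orthogonal psi ->
    wave_orthogonal (fun t => psi t * (1 - p t ^+ n) ^+ m).
  move=> opsi; elim: m => [|m IH].
    by move: opsi; congr wave_orthogonal; apply/funext => t; rewrite expr0 mulr1.
  have := wave_orthogonal_lin 1 (-1) IH (Xp n _ IH).
  by congr wave_orthogonal; apply/funext => t; rewrite exprSr; ring.
move=> op; have [[_ [C phiC]] _] := op.
apply: (@wave_orthogonal_lim _ _ C (fun n => Xq n (n * 2 ^ n)%N _ op)) => [n t|t].
  have /andP[p0 p1] := p01 t.
  rewrite normrM -[X in _ <= X]mulr1 ler_pM//.
  have q0 : 0 <= 1 - p t ^+ n by rewrite subr_ge0 exprn_ile1.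
  rewrite ger0_norm ?exprn_ge0// exprn_ile1// lerBlDr lerDl exprn_ge0//.
by apply: cvgM; [exact: cvg_cst|exact: (cvg_threshold (p01 t))].
Qed.

(** Quantifying over all multipliers makes this stable under intersection, which
    is not clear for the sets over which g has integral 0; so these sets form a
    sigma-algebra and no pi-lambda argument is needed. *)
Definition cuttable (E : set plane) := measurable E /\
  forall phi, wave_orthogonal phi -> wave_orthogonal (fun t => phi t * \1_E t).

Lemma cuttableC E : cuttable E -> cuttable (~` E).
Proof.
move=> [mE cE]; split; first exact: measurableC.
move=> phi op; have := wave_orthogonal_lin 1 (-1) op (cE _ op).
congr wave_orthogonal; apply/funext => t.
by rewrite !indicE in_setC; case: (t \in E) => /=; ring.
Qed.

Lemma cuttableI E F : cuttable E -> cuttable F -> cuttable (E `&` F).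
Proof.
move=> [mE cE] [mF cF]; split; first exact: measurableI.
move=> phi op; have := cF _ (cE _ op).
congr wave_orthogonal; apply/funext => t.
by rewrite !indicE in_setI; case: (t \in E); case: (t \in F) => /=; ring.
Qed.

Lemma cuttable_sigma_algebra : sigma_algebra setT cuttable.
Proof.
have cut0 : cuttable set0.
  split=> // phi op; have := wave_orthogonal_lin 0 0 op op.
  congr wave_orthogonal; apply/funext => t.
  by rewrite indicE in_set0 /=; ring.
split => //; first by move=> E cE; rewrite setTD; exact: cuttableC.
move=> F cF.
have cU n : cuttable (\big[setU/set0]_(i < n) F i).
  elim: n => [|n IH]; first by rewrite big_ord0.
  rewrite big_ord_recr /= -[_ `|` _]setCK setCU.
  by apply/cuttableC/cuttableI; exact: cuttableC.
split; first by apply: bigcup_measurable => i _; exact: (cF i).1.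
move=> phi op; have [[_ [C phiC]] _] := op.
apply: (@wave_orthogonal_lim _ _ C (fun n => (cU n).2 _ op)) => [n t|t].
  rewrite normrM -[X in _ <= X]mulr1 ler_pM// indicE.
  by case: (_ \in _); rewrite ?normr1 ?normr0.
apply: cvgM; first exact: cvg_cst.
apply: cvg_near_cst.
have [[N _ FNt]|nt] := pselect ((\bigcup_i F i) t).
  exists N.+1 => // n /= Nn.
  rewrite !indicE !mem_set//; first by exists N.
  by rewrite -bigcup_mkord; exists N.
apply: nearW => n; rewrite !indicE !memNset//.
by rewrite -bigcup_mkord => -[i _ Fit]; apply: nt; exists i.
Qed.

(** For 0 <= a < 1 and x in [0, 1[, the condition a < x reads
    sin (pi x) sin (pi (x - a)) > 0, and this product is half of
    cos (pi a) - cos (2 pi x - pi a), an affine function of a wave. *)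
Lemma cuttable_preimage (pr : plane -> line) (k : int * int) :
  measurable_fun [set: plane] pr ->
  (forall t, dotv (freq k) t = pr t) ->
  (forall t, D t -> 0 <= pr t < 1) ->
  forall X : set line, measurable X -> cuttable (pr @^-1` X).
Proof.
move=> mpr kpr prD.
have [cut0 cutC cutU] := cuttable_sigma_algebra.
pose G := [set X : set line | cuttable (pr @^-1` X)].
suff : (@measurable _ line) `<=` G by move=> h X; exact: h.
rewrite [X in X `<=` _]RGenOInfty.measurableE.
apply: smallest_sub.
  split; rewrite /G /=.
  - by rewrite preimage_set0.
  - by move=> A cA; rewrite setTD preimage_setC; exact: cuttableC.
  - by move=> F cF; rewrite preimage_bigcup; exact: cutU.
move=> _ [a ->]; rewrite /G /=.
have mE : measurable (pr @^-1` `]a, +oo[).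
  by rewrite -[X in measurable X]setTI; exact: mpr.
split=> // phi op.
have bE : bounded_measurable (fun t => phi t * \1_(pr @^-1` `]a, +oo[) t).
  apply: bounded_measurableM; first exact: op.1.
  split; first exact: measurable_indic.
  by exists 1 => t; rewrite indicE; case: (_ \in _); rewrite ?normr1 ?normr0.
have iE t : \1_(pr @^-1` `]a, +oo[) t = (a < pr t)%R%:R :> R.
  by rewrite indicE; congr ((nat_of_bool _)%:R); apply/idP/idP; rewrite inE /= in_itv/= andbT.
(* Within the square the condition is void for a < 0, impossible for a >= 1. *)
have [a0|a0] := ltP a 0.
  apply: wave_orthogonal_eq bE _ op => t Dt.
  by rewrite iE (lt_le_trans a0) ?mulr1//; have /andP[] := prD t Dt.
have [a1|a1] := leP 1 a.
  have := wave_orthogonal_lin 0 0 op op.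
  apply: wave_orthogonal_eq bE _ => t Dt.
  rewrite iE ltNge (le_trans _ a1) ?mulr0 ?mul0r ?addr0//.
  by rewrite ltW//; have /andP[] := prD t Dt.
(* The threshold 1/2 for al + wave / 4 is the threshold 0 for the product. *)
pose al : R := 2^-1 - 4^-1 * cos (pi * a).
pose th : R := - (pi * a).
have pE (t : R * R) : al + 4^-1 * wave k th t =
    2^-1 - 2^-1 * (sin (pi * pr t) * sin (pi * (pr t - a))).
  rewrite /al /th /wave kpr.
  have -> : 2 * pi * pr t + - (pi * a) = pi * pr t + pi * (pr t - a) by ring.
  have -> : pi * a = pi * pr t - pi * (pr t - a) by ring.
  by rewrite cosB cosD; lra.
have p01 (t : R * R) : 0 <= al + 4^-1 * wave k th t <= 1.
  have := cos_geN1 (pi * a); have := cos_le1 (pi * a).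
  have := wave_le1 k th t; rewrite ler_norml => /andP[].
  by rewrite /al; lra.
have := wave_orthogonal_threshold p01 op.
apply: wave_orthogonal_eq bE _ => t Dt.
rewrite iE pE; congr (_ * (nat_of_bool _)%:R).
rewrite gtrBl pmulr_rgt0 ?invr_gt0//.
have /andP[pr0 pr1] := prD t Dt.
have pi0 := pi_gt0 R.
have [at_|ta] := ltP a (pr t).
  by rewrite mulr_gt0// sin_gt0_pi//; nra.
apply/negbTE; rewrite -leNgt mulr_ge0_le0//.
  by rewrite sin_ge0_pi//; nra.
rewrite -[pi * _]opprK sinN oppr_le0 sin_ge0_pi//; nra.
Qed.

Lemma measurable_cuttable (E : set plane) : measurable E -> cuttable E.
Proof.
suff : (@measurable _ plane) `<=` cuttable by apply.
rewrite [X in X `<=` _](_ : _ = g_sigma_preimageU (@fst line line) (@snd line line))//.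
apply: smallest_sub; first exact: cuttable_sigma_algebra.
move=> _ [[X mX <-]|[X mX <-]]; rewrite setTI.
  apply: (@cuttable_preimage _ (1, 0)) => //.
    by move=> t; rewrite /dotv /=; ring.
  by move=> t [] /=; rewrite in_itv/=.
apply: (@cuttable_preimage _ (0, 1)) => //.
  by move=> t; rewrite /dotv /=; ring.
by move=> t [] /=; rewrite in_itv/=.
Qed.

(** The constant 1 is a multiplier and every Borel set E is cuttable, so g has
    integral 0 over E. *)
Theorem fourier_uniqueness :
  (forall k th, \int[lam2]_(t in D) (g t * wave k th t) = 0) ->
  ae_eq lam2 D (EFin \o g) (cst 0%E).
Proof.
move=> g0.
have o1 : wave_orthogonal (cst 1).
  split; first by split => //; exists 1 => t; rewrite normr1.
  by move=> k th; rewrite -[RHS](g0 k th); apply: eq_Rintegral => t _; rewrite mul1r.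
apply: integral_ae_eq => // E ED mE.
rewrite integral0.
have [bE oE] := (measurable_cuttable mE).2 _ o1.
have := oE 0 0; rewrite /Rintegral.
rewrite (@eq_integral _ _ _ _ _ ((EFin \o g) \_ E)); last first.
  move=> t _; rewrite patchE indicE /wave /dotv /= !mul0r !addr0 mulr0 cos0 mul1r mulr1.
  by case: (t \in E); rewrite ?mulr1 ?mulr0.
rewrite -integral_mkcondr setIidr// => h.
by rewrite -[LHS]fineK ?h//; apply: integrable_fin_num => //; exact: integrableS ig.
Qed.

End Uniqueness.

(** * Trigonometric sums and Parseval's identity *)

Section Parseval.
Context {R : realType}.
Local Notation plane := (measurableTypeR R * measurableTypeR R)%type.
Local Notation lam2 := (@lebesgue_measure2 R).
Local Notation D := (@unit_square R).
Local Notation normc := ComplexField.Normc.normc.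
Local Notation Re := complex.Re.
Local Notation Im := complex.Im.

Lemma ReD (x y : R[i]) : Re (x + y) = Re x + Re y.
Proof. by case: x y => [a b] [c d]. Qed.

Lemma ImRe (x : R[i]) : Im x = Re (x * - 'i%C).
Proof. by case: x => a b /=; ring. Qed.

Lemma normc_sqr (z : R[i]) : normc z ^+ 2 = Re (z * conjc z).
Proof.
case: z => a b /=; rewrite sqr_sqrtr ?addr_ge0 ?sqr_ge0//; ring.
Qed.

Lemma normc_sqrE (z : R[i]) : normc z ^+ 2 = Re z ^+ 2 + Im z ^+ 2.
Proof. by case: z => a b /=; rewrite sqr_sqrtr ?addr_ge0 ?sqr_ge0. Qed.

Lemma normc_ge0 (z : R[i]) : 0 <= normc z.
Proof. by case: z => a b /=; exact: sqrtr_ge0. Qed.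

Lemma Re_le_normc (z : R[i]) : Re z <= normc z.
Proof.
apply: le_trans (ler_norm _) _.
rewrite -(ler_sqr (x := `|_|)) ?nnegrE ?normc_ge0// normc_sqrE.
by rewrite real_normK ?num_real// lerDl sqr_ge0.
Qed.

Lemma normc_conj (z : R[i]) : normc (conjc z) = normc z.
Proof. by case: z => a b /=; rewrite sqrrN. Qed.

Lemma expiD (x y : R) : expi (x + y) = expi x * expi y.
Proof.
rewrite /expi cosD sinD; apply/eqP; rewrite eq_complex /=.
by apply/andP; split; apply/eqP; ring.
Qed.

Lemma expiN (x : R) : expi (- x) = conjc (expi x).
Proof. by rewrite /expi cosN sinN. Qed.

Definition character (k : int * int) (t : R * R) : R[i] :=
  expi (2 * pi * dotv (freq k) t).

Lemma characterD k l t : character (k + l) t = character k t * character l t.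
Proof. by rewrite /character freqD dotvDl mulrDr expiD. Qed.

Lemma characterN k t : character (- k) t = conjc (character k t).
Proof. by rewrite /character freqN dotvNl mulrN expiN. Qed.

Lemma Re_character (z : R[i]) k t :
  Re (z * character k t) = Re z * wave k 0 t + Im z * wave k (pi / 2) t.
Proof.
rewrite /wave addr0 cosDpihalf /character /expi; case: z => a b /=; ring.
Qed.

Lemma bounded_Re_character (z : R[i]) k :
  bounded_measurable (fun t => Re (z * character k t)).
Proof.
rewrite (_ : (fun _ => _) =
    (fun t => Re z * wave k 0 t + Im z * wave k (pi / 2) t)).
  by apply: bounded_measurable_lin; exact: bounded_measurable_wave.
by apply/funext => t; rewrite Re_character.
Qed.

Lemma bounded_integrable (phi : plane -> R) : bounded_measurable phi ->
  lam2.-integrable D (EFin \o phi).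
Proof. by move=> [mphi [C phiC]]; exact: bounded_integrable_square phiC. Qed.

Lemma integral_Re_character (z : R[i]) k :
  \int[lam2]_(t in D) Re (z * character k t) = if k == 0 then Re z else 0.
Proof.
rewrite (@eq_Rintegral _ _ _ _ _
    (fun t : plane => Re z * wave k 0 t + Im z * wave k (pi / 2) t)); last first.
  by move=> t _; rewrite Re_character.
have mD := @measurable_unit_square R.
have i1 := bounded_integrable (bounded_measurable_wave k 0).
have i2 := bounded_integrable (bounded_measurable_wave k (pi / 2)).
rewrite RintegralD//; [|exact: (integrableZl mD _ i1)|exact: (integrableZl mD _ i2)].
rewrite !RintegralZl// !integral_wave; case: ifP => _.
  by rewrite cos0 cos_pihalf mulr1 mulr0 addr0.
by rewrite !mulr0 addr0.
Qed.

Section TrigSum.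
Context (I : Type) (r : seq I) (d : I -> R[i]) (f : I -> int * int).

(** Indices are separate from frequencies so that a frequency may occur several
    times, as it does in the square of a sum. *)
Definition trig_sum (t : R * R) : R[i] := \sum_(i <- r) d i * character (f i) t.

End TrigSum.

Lemma bounded_Re_trig_sum (I : Type) (r : seq I) d f :
  bounded_measurable (fun t => Re (trig_sum r d f t)).
Proof.
elim: r => [|i r IH].
  rewrite (_ : (fun _ => _) = cst 0).
    by split => //; exists 0 => t; rewrite normr0.
  by apply/funext => t; rewrite /trig_sum big_nil.
rewrite (_ : (fun _ => _) = (fun t =>
    1 * Re (d i * character (f i) t) + 1 * Re (trig_sum r d f t))).
  by apply: bounded_measurable_lin => //; exact: bounded_Re_character.
by apply/funext => t; rewrite /trig_sum big_cons ReD !mul1r.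
Qed.

Lemma integral_Re_trig_sum (I : Type) (r : seq I) d f :
  \int[lam2]_(t in D) Re (trig_sum r d f t) = Re (\sum_(i <- r | f i == 0) d i).
Proof.
elim: r => [|i r IH].
  rewrite (@eq_Rintegral _ _ _ _ _ (cst 0)); last first.
    by move=> t _; rewrite /trig_sum big_nil.
  by rewrite Rintegral_cst ?big_nil ?mul0r//; exact: measurable_unit_square.
rewrite (@eq_Rintegral _ _ _ _ _ (fun t : plane =>
    Re (d i * character (f i) t) + Re (trig_sum r d f t))); last first.
  by move=> t _; rewrite /trig_sum big_cons ReD.
rewrite RintegralD//.
- rewrite IH integral_Re_character big_cons; case: ifP => _; first by rewrite ReD.
  by rewrite add0r.
- exact: measurable_unit_square.
- exact: (bounded_integrable (bounded_Re_character _ _)).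
- exact: (bounded_integrable (bounded_Re_trig_sum _ _ _)).
Qed.

Lemma trig_sumZ (I : Type) (r : seq I) d f (z : R[i]) t :
  trig_sum r d f t * z = trig_sum r (fun i => d i * z) f t.
Proof. by rewrite /trig_sum mulr_suml; apply: eq_bigr => i _; rewrite mulrAC. Qed.

Lemma bounded_Im_trig_sum (I : Type) (r : seq I) d f :
  bounded_measurable (fun t => Im (trig_sum r d f t)).
Proof.
under eq_fun do rewrite ImRe trig_sumZ; exact: bounded_Re_trig_sum.
Qed.

Lemma cintegral_trig_sum (I : Type) (r : seq I) d f :
  cintegral D (trig_sum r d f) = \sum_(i <- r | f i == 0) d i.
Proof.
rewrite /cintegral integral_Re_trig_sum.
rewrite (@eq_Rintegral _ _ _ _ _ (fun t : plane =>
    Re (trig_sum r (fun i => d i * - 'i%C) f t))); last first.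
  by move=> t _; rewrite ImRe trig_sumZ.
rewrite integral_Re_trig_sum -mulr_suml -ImRe.
by case: (\sum_(i <- r | _) _).
Qed.

Lemma trig_sumM (I J : Type) (r : seq I) (q : seq J) d c f h t :
  trig_sum r d f t * trig_sum q c h t =
  trig_sum [seq (i, j) | i <- r, j <- q] (fun p => d p.1 * c p.2)
    (fun p => f p.1 + h p.2) t.
Proof.
rewrite /trig_sum big_allpairs big_distrl; apply: eq_bigr => i _.
rewrite big_distrr; apply: eq_bigr => j _ /=.
by rewrite characterD mulrACA.
Qed.

Lemma conjc_sum (I : Type) (r : seq I) (F : I -> R[i]) :
  conjc (\sum_(i <- r) F i) = \sum_(i <- r) conjc (F i).
Proof. exact: rmorph_sum. Qed.

Lemma trig_sumJ (I : Type) (r : seq I) d f t :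
  conjc (trig_sum r d f t) = trig_sum r (fun i => conjc (d i)) (fun i => - f i) t.
Proof.
rewrite /trig_sum conjc_sum; apply: eq_bigr => i _.
by rewrite characterN; exact: rmorphM.
Qed.

Lemma parseval (I : Type) (r : seq I) d f :
  \int[lam2]_(t in D) normc (trig_sum r d f t) ^+ 2 =
  Re (\sum_(i <- r) \sum_(j <- r | f i == f j) d i * conjc (d j)).
Proof.
rewrite (@eq_Rintegral _ _ _ _ _ (fun t : plane => Re
   (trig_sum [seq (i, j) | i <- r, j <- r] (fun p => d p.1 * conjc (d p.2))
    (fun p => f p.1 - f p.2) t))); last first.
  by move=> t _; rewrite normc_sqr trig_sumJ trig_sumM.
rewrite integral_Re_trig_sum big_mkcond big_allpairs; congr Re.
apply: eq_bigr => i _; rewrite [RHS]big_mkcond; apply: eq_bigr => j _ /=.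
by rewrite subr_eq0.
Qed.

(** Reduces fourth moments to Parseval's identity, as |P|^4 = |P^2|^2. *)
Lemma normc_trig_sum_exp4 (I : Type) (r : seq I) d f t :
  normc (trig_sum r d f t) ^+ 4 =
  normc (trig_sum [seq (i, j) | i <- r, j <- r] (fun p => d p.1 * d p.2)
    (fun p => f p.1 + f p.2) t) ^+ 2.
Proof. by rewrite -trig_sumM ComplexField.Normc.normcM -expr2 -exprM. Qed.

End Parseval.

(** * Additive energy *)

Section AdditiveEnergy.
Context {R : realFieldType} {G : zmodType}.
Implicit Types (s : seq G) (f : G -> R).

(** The additive property of a set of points on a circle centered at 0: a nonzero
    sum determines its two terms. *)
Definition trivial_sums s := forall a b c d, a \in s -> b \in s -> c \in s -> d \in s ->
  a + b = c + d -> [\/ c = a /\ d = b, c = b /\ d = a | b = - a /\ d = - c].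

(** The weighted number of additive quadruples: for f = 1 this is the additive
    energy of s in the sense of additive combinatorics. *)
Definition energy s f : R := \sum_(a <- s) \sum_(b <- s) \sum_(c <- s) \sum_(d <- s)
  (a + b == c + d)%:R * (f a * f b * (f c * f d)).

Lemma sum_delta s (h : G -> R) x : uniq s ->
  \sum_(c <- s) (c == x)%:R * h c = (x \in s)%:R * h x.
Proof.
move=> us; have [xs|xs] := boolP (x \in s).
  rewrite (bigD1_seq x)//= eqxx mul1r big1 ?addr0 ?mul1r// => c /negbTE ->.
  by rewrite mul0r.
rewrite mul0r big_seq big1// => c cs.
by rewrite (_ : c == x = false) ?mul0r//; apply: contraNF xs => /eqP <-.
Qed.

Lemma sum_quad s (h1 h2 : G -> G -> R) :
  \sum_(a <- s) \sum_(b <- s) \sum_(c <- s) \sum_(d <- s) (h1 a b * h2 c d) =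
  (\sum_(a <- s) \sum_(b <- s) h1 a b) * (\sum_(c <- s) \sum_(d <- s) h2 c d).
Proof.
rewrite mulr_suml; apply: eq_bigr => a _.
rewrite mulr_suml; apply: eq_bigr => b _.
rewrite mulr_sumr; apply: eq_bigr => c _.
by rewrite mulr_sumr.
Qed.

Lemma sum_pair_same s f : uniq s ->
  \sum_(a <- s) \sum_(b <- s) \sum_(c <- s) \sum_(d <- s)
    ((c == a) && (d == b))%:R * (f a * f b * (f c * f d)) =
  (\sum_(a <- s) f a ^+ 2) ^+ 2.
Proof.
move=> us; rewrite [RHS]expr2 [RHS]mulr_suml.
apply: eq_big_seq => a as_; rewrite mulr_sumr.
apply: eq_big_seq => b bs.
transitivity (\sum_(c <- s) (c == a)%:R * (f a * f b * (f c * f b))).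
  apply: eq_bigr => c _.
  under eq_bigr => d _ do rewrite -mulnb natrM mulrAC mulrC.
  by rewrite sum_delta// bs mul1r.
by rewrite sum_delta// as_ mul1r; ring.
Qed.

Lemma sum_pair_swap s f : uniq s ->
  \sum_(a <- s) \sum_(b <- s) \sum_(c <- s) \sum_(d <- s)
    ((c == b) && (d == a))%:R * (f a * f b * (f c * f d)) =
  (\sum_(a <- s) f a ^+ 2) ^+ 2.
Proof.
move=> us; rewrite -(sum_pair_same f us) exchange_big /=.
apply: eq_bigr => a _; apply: eq_bigr => b _; apply: eq_bigr => c _.
by apply: eq_bigr => d _; rewrite (mulrC (f b)).
Qed.

Lemma sum_pair_opp s f :
  \sum_(a <- s) \sum_(b <- s) \sum_(c <- s) \sum_(d <- s)
    ((b == - a) && (d == - c))%:R * (f a * f b * (f c * f d)) =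
  (\sum_(a <- s) \sum_(b <- s) (b == - a)%:R * (f a * f b)) ^+ 2.
Proof.
rewrite expr2 -sum_quad.
apply: eq_bigr => a _; apply: eq_bigr => b _; apply: eq_bigr => c _.
by apply: eq_bigr => d _; rewrite -mulnb natrM mulrACA.
Qed.

(** Each product is at most half the sum of the squares, and every element has at
    most one opposite in s. *)
Lemma sum_opp_le s f : uniq s ->
  \sum_(a <- s) \sum_(b <- s) (b == - a)%:R * (f a * f b) <= \sum_(a <- s) f a ^+ 2.
Proof.
move=> us.
have half : \sum_(a <- s) \sum_(b <- s) (b == - a)%:R * (2^-1 * f a ^+ 2) <=
    2^-1 * \sum_(a <- s) f a ^+ 2.
  rewrite mulr_sumr; apply: ler_sum => a _; rewrite sum_delta//.
  by case: (_ \in _); rewrite ?mul1r ?mul0r// mulr_ge0// sqr_ge0.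
have half' : \sum_(a <- s) \sum_(b <- s) (b == - a)%:R * (2^-1 * f b ^+ 2) <=
    2^-1 * \sum_(a <- s) f a ^+ 2.
  rewrite exchange_big /=; apply: le_trans half.
  apply: ler_sum => a _; apply: ler_sum => b _.
  by rewrite [a == _]eq_sym eqr_oppLR.
rewrite [leRHS](_ : _ = 2^-1 * \sum_(a <- s) f a ^+ 2 + 2^-1 * \sum_(a <- s) f a ^+ 2);
  last by field.
apply: le_trans (lerD half half'); rewrite -big_split /=.
apply: ler_sum => a _; rewrite -big_split /=; apply: ler_sum => b _.
rewrite -mulrDr ler_wpM2l//.
have := sqr_ge0 (f a - f b); rewrite sqrrB; lra.
Qed.

Lemma ler_sum4 s (h k : G -> G -> G -> G -> R) :
  (forall a b c d, a \in s -> b \in s -> c \in s -> d \in s -> h a b c d <= k a b c d) ->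
  \sum_(a <- s) \sum_(b <- s) \sum_(c <- s) \sum_(d <- s) h a b c d <=
  \sum_(a <- s) \sum_(b <- s) \sum_(c <- s) \sum_(d <- s) k a b c d.
Proof.
move=> hk.
rewrite big_seq [leRHS]big_seq; apply: ler_sum => a as_.
rewrite big_seq [leRHS]big_seq; apply: ler_sum => b bs.
rewrite big_seq [leRHS]big_seq; apply: ler_sum => c cs.
rewrite big_seq [leRHS]big_seq; apply: ler_sum => d ds.
exact: hk.
Qed.

Lemma sum4D s (h k : G -> G -> G -> G -> R) :
  \sum_(a <- s) \sum_(b <- s) \sum_(c <- s) \sum_(d <- s) (h a b c d + k a b c d) =
  \sum_(a <- s) \sum_(b <- s) \sum_(c <- s) \sum_(d <- s) h a b c d +
  \sum_(a <- s) \sum_(b <- s) \sum_(c <- s) \sum_(d <- s) k a b c d.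
Proof.
rewrite -big_split; apply: eq_bigr => a _; rewrite -big_split; apply: eq_bigr => b _.
by rewrite -big_split; apply: eq_bigr => c _; rewrite -big_split.
Qed.

(** The three families of trivial solutions cover all the quadruples, and each
    contributes at most the square of the sum of f^2. *)
Lemma energy_le s f : uniq s -> trivial_sums s -> (forall a, 0 <= f a) ->
  energy s f <= 3 * (\sum_(a <- s) f a ^+ 2) ^+ 2.
Proof.
move=> us rf f0; set S := \sum_(a <- s) f a ^+ 2.
have S0 : 0 <= S by apply: sumr_ge0 => a _; exact: sqr_ge0.
have U : (\sum_(a <- s) \sum_(b <- s) (b == - a)%:R * (f a * f b)) ^+ 2 <= S ^+ 2.
  rewrite lerXn2r ?nnegrE ?sum_opp_le//.
  apply: sumr_ge0 => a _; apply: sumr_ge0 => b _.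
  by rewrite mulr_ge0// mulr_ge0.
have -> : 3 * S ^+ 2 = S ^+ 2 + S ^+ 2 + S ^+ 2 by ring.
apply: le_trans (lerD (lexx _) U).
rewrite -sum_pair_opp -{1}(sum_pair_same f us) -(sum_pair_swap f us) -!sum4D.
apply: ler_sum4 => a b c d as_ bs cs ds.
have X0 : 0 <= f a * f b * (f c * f d) by rewrite !mulr_ge0.
rewrite -!mulrDl ler_wpM2r// -!natrD ler_nat.
case: eqP => // /(rf _ _ _ _ as_ bs cs ds) [] [-> ->]; rewrite !eqxx //=.
  by rewrite addnAC addn1.
by rewrite addn1.
Qed.

(** Bonferroni's inequality: by symmetry of s each family of trivial solutions has
    N^2 members, and two of them share at most N, because a quadruple in two
    families is determined by its first entry. *)
Lemma energy1_ge s : uniq s -> trivial_sums s -> (forall a, a \in s -> - a \in s) ->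
  3 * (size s)%:R ^+ 2 - 3 * (size s)%:R <= energy s (fun=> 1 : R).
Proof.
move=> us rf sN; set N : R := (size s)%:R.
have N1 : \sum_(a <- s) (1 : R) ^+ 2 = N.
  by rewrite big_const_seq count_predT expr1n iter_addr addr0.
have cnt (x : G) : \sum_(c <- s) (c == x)%:R = (x \in s)%:R :> R.
  by rewrite -[RHS]mulr1 -(sum_delta (fun=> 1) x us); apply: eq_bigr => c _; rewrite mulr1.
pose T (P : G -> G -> G -> G -> bool) : R :=
  \sum_(a <- s) \sum_(b <- s) \sum_(c <- s) \sum_(d <- s) (P a b c d)%:R * (1 * 1 * (1 * 1)).
have T1 : T (fun a b c d => (c == a) && (d == b)) = N ^+ 2.
  by rewrite /T (sum_pair_same (fun=> 1)) // N1.
have T2 : T (fun a b c d => (c == b) && (d == a)) = N ^+ 2.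
  by rewrite /T (sum_pair_swap (fun=> 1)) // N1.
have T3 : T (fun a b c d => (b == - a) && (d == - c)) = N ^+ 2.
  rewrite /T (sum_pair_opp s (fun=> 1)) -{1}N1; congr (_ ^+ 2).
  apply: eq_big_seq => a as_; rewrite -mulr_suml cnt sN// !mulr1 expr1n//.
(* Quadruples in which b, c and d are functions of a. *)
have single (x y z : G -> G) (P : G -> G -> G -> G -> bool) :
    (forall a b c d, P a b c d = [&& b == x a, c == y a & d == z a]) -> T P <= N.
  move=> PE; rewrite -N1; apply: ler_sum => a _.
  have le1 w : (w \in s)%:R <= 1 :> R by case: (_ \in _).
  rewrite expr1n.
  apply: le_trans (le1 (x a)); rewrite -cnt; apply: ler_sum => b _.
  rewrite -[leRHS]mulr1.
  under eq_bigr => c _ do under eq_bigr => d _ do rewrite PE -!mulnb !natrM !mulr1.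
  under eq_bigr => c _ do rewrite -!mulr_sumr.
  rewrite -mulr_sumr ler_wpM2l//.
  under eq_bigr => c _ do rewrite cnt.
  rewrite -mulr_suml cnt -[leRHS]mulr1 ler_pM//.
have T12 : T (fun a b c d => [&& c == a, d == b & b == a]) <= N.
  apply: (@single id id id) => a b c d; apply/and3P/and3P => -[/eqP-> /eqP-> /eqP->]//.
have T13 : T (fun a b c d => [&& c == a, d == b & b == - a]) <= N.
  by apply: (@single -%R id -%R) => a b c d; apply/and3P/and3P => -[/eqP-> /eqP-> /eqP->].
have T23 : T (fun a b c d => [&& c == b, d == a & b == - a]) <= N.
  by apply: (@single -%R -%R id) => a b c d; apply/and3P/and3P => -[/eqP-> /eqP-> /eqP->].
suff H : T (fun a b c d => (c == a) && (d == b)) + T (fun a b c d => (c == b) && (d == a)) +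
   T (fun a b c d => (b == - a) && (d == - c)) <=
   energy s (fun=> 1) + T (fun a b c d => [&& c == a, d == b & b == a]) +
   T (fun a b c d => [&& c == a, d == b & b == - a]) +
   T (fun a b c d => [&& c == b, d == a & b == - a]).
  rewrite T1 T2 T3 in H; lra.
rewrite /T /energy -!sum4D; apply: ler_sum4 => a b c d as_ bs cs ds.
rewrite -!mulrDl ler_wpM2r ?mulr1// -!natrD ler_nat.
have E1 : (c == a) && (d == b) ==> (a + b == c + d).
  by apply/implyP => /andP[/eqP-> /eqP->].
have E2 : (c == b) && (d == a) ==> (a + b == c + d).
  by apply/implyP => /andP[/eqP-> /eqP->]; rewrite addrC.
have E3 : (b == - a) && (d == - c) ==> (a + b == c + d).
  by apply/implyP => /andP[/eqP-> /eqP->]; rewrite !subrr.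
have E12 : (c == a) && (d == b) && ((c == b) && (d == a)) ==> [&& c == a, d == b & b == a].
  by apply/implyP => /andP[/andP[/eqP-> /eqP->] /andP[_ ->]]; rewrite !eqxx.
have E13 : (c == a) && (d == b) && ((b == - a) && (d == - c)) ==> [&& c == a, d == b & b == - a].
  by apply/implyP => /andP[/andP[/eqP-> /eqP->] /andP[-> _]]; rewrite !eqxx.
have E23 : (c == b) && (d == a) && ((b == - a) && (d == - c)) ==> [&& c == b, d == a & b == - a].
  by apply/implyP => /andP[/andP[/eqP-> /eqP->] /andP[-> _]]; rewrite !eqxx.
move: E1 E2 E3 E12 E13 E23.
move: ((c == a) && (d == b)) ((c == b) && (d == a)) ((b == - a) && (d == - c)) (a + b == c + d).
by do 4 case=> //=; do 3 case: [&& _, _ & _].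
Qed.

End AdditiveEnergy.

(** * Reduction to the unit square *)

Section TorusTransport.
Context {R : realType}.
Local Notation plane := (measurableTypeR R * measurableTypeR R)%type.
Local Notation lam2 := (@lebesgue_measure2 R).
Local Notation D := (@unit_square R).
Local Notation normc := ComplexField.Normc.normc.
Local Notation Re := complex.Re.
Local Notation Im := complex.Im.

Lemma det_mx22 (A : 'M[R]_2) : \det A = A 0 0 * A 1 1 - A 0 1 * A 1 0.
Proof.
rewrite (expand_det_row _ 0) !big_ord_recl big_ord0 addr0 /cofactor !det_mx11 !mxE /=.
rewrite expr0 mul1r expr1 mulN1r mulrN.
by congr (_ * A _ _ - A _ _ * A _ _); apply: val_inj.
Qed.

Lemma mulmxv_mul (A B : 'M[R]_2) x : mulmxv A (mulmxv B x) = mulmxv (A *m B) x.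
Proof.
rewrite /mulmxv /= !mxE !big_ord_recl !big_ord0 !addr0.
rewrite (_ : lift ord0 ord0 = 1 :> 'I_2); last exact: val_inj.
by congr pair; ring.
Qed.

Lemma mulmxv1 x : mulmxv (1%:M : 'M[R]_2) x = x.
Proof. by case: x => x y; rewrite /mulmxv !mxE /= !mul1r !mul0r addr0 add0r. Qed.

Lemma mulmxvK (A : 'M[R]_2) x : A \in unitmx -> mulmxv (invmx A) (mulmxv A x) = x.
Proof. by move=> uA; rewrite mulmxv_mul mulVmx// mulmxv1. Qed.

Lemma mulmxvVK (A : 'M[R]_2) x : A \in unitmx -> mulmxv A (mulmxv (invmx A) x) = x.
Proof. by move=> uA; rewrite mulmxv_mul mulmxV// mulmxv1. Qed.

Lemma mulmxvD (A : 'M[R]_2) x y : mulmxv A (x + y) = mulmxv A x + mulmxv A y.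
Proof. by rewrite /mulmxv /=; congr pair => /=; ring. Qed.

Lemma dotv_tr (A : 'M[R]_2) x y : dotv (mulmxv A^T x) y = dotv x (mulmxv A y).
Proof. by rewrite /dotv /mulmxv /= !mxE; ring. Qed.

Lemma scales_area_mulmxv (A : 'M[R]_2) : A \in unitmx ->
  scales_area (mulmxv A) `|\det A|.
Proof.
rewrite unitmxE unitfE det_mx22 => D0.
exact: scales_area_linear.
Qed.

Lemma measurable_mulmxv (A : 'M[R]_2) :
  measurable_fun [set: plane] (mulmxv A : plane -> plane).
Proof.
apply: measurable_fun_pair; apply: measurable_funD; exact: measurable_funM.
Qed.

Lemma fundamental_domainE (A : 'M[R]_2) : A \in unitmx ->
  fundamental_domain A = mulmxv (invmx A) @^-1` D.
Proof.
move=> uA; apply/seteqP; split => x.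
  by move=> [t Dt <-] /=; rewrite mulmxvK.
by move=> Dx; exists (mulmxv (invmx A) x) => //; rewrite mulmxvVK.
Qed.

Lemma measurable_fundamental_domain (A : 'M[R]_2) : A \in unitmx ->
  measurable (fundamental_domain A : set plane).
Proof.
move=> uA; rewrite fundamental_domainE// -[X in measurable X]setTI.
exact: (measurable_mulmxv _ measurableT measurable_unit_square).
Qed.

Lemma preimage_fundamental_domain (A : 'M[R]_2) : A \in unitmx ->
  mulmxv A @^-1` fundamental_domain A = D.
Proof.
move=> uA; rewrite fundamental_domainE//; apply/seteqP; split => x /=;
by rewrite mulmxvK.
Qed.

Lemma poweRn (x : \bar R) n : (0 <= x)%E -> (0 < n)%N -> (x `^ n%:R = x ^+ n)%E.
Proof.
case: x => [r| |]//; first by rewrite lee_fin -EFin_expe => r0 _; congr EFin; exact: powR_mulrn.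
move=> _; case: n => // n _; rewrite poweRyr ?pnatr_eq0//.
by elim: n => [|n IH]; rewrite expeS ?expe0 ?mule1// -IH mulyy.
Qed.

Lemma torus_norm_pow (A : 'M[R]_2) n u : A \in unitmx -> (0 < n)%N ->
  (torus_norm A n%:R u ^+ n =
    \int[lam2]_(x in fundamental_domain A) ((normc (u x)) ^+ n)%:E)%E.
Proof.
move=> uA n0; rewrite -poweRn//; last exact: Lnorm_ge0.
rewrite /torus_norm poweR_Lnorm ?pnatr_eq0 -?lt0n// [RHS]integral_mkcond.
apply: eq_integral => x _; rewrite !patchE.
have w0 : 0 <= normc (u x) by exact: normc_ge0.
case: ifP => _ /=.
  by rewrite ger0_norm// powR_mulrn.
by rewrite normr0 powR0// pnatr_eq0 -lt0n.
Qed.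

Lemma measurable_normc (v : plane -> R[i]) :
  measurable_fun [set: plane] (fun t => Re (v t)) ->
  measurable_fun [set: plane] (fun t => Im (v t)) ->
  measurable_fun [set: plane] (fun t => normc (v t)).
Proof.
move=> mR mI.
rewrite (_ : (fun _ => _) =
    (@powR R ^~ 2^-1) \o (fun t => Re (v t) ^+ 2 + Im (v t) ^+ 2)).
  apply: measurableT_comp; first exact: measurable_powR.
  by apply: measurable_funD; exact: measurable_funX.
apply/funext => t /=; rewrite powR12_sqrt ?addr_ge0 ?sqr_ge0//.
by case: (v t).
Qed.

Lemma torus_norm_transport (A : 'M[R]_2) n u : A \in unitmx -> (0 < n)%N ->
  measurable_fun [set: plane] (fun x => Re (u x)) ->
  measurable_fun [set: plane] (fun x => Im (u x)) ->
  (torus_norm A n%:R u ^+ n =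
    `|\det A|%:E * \int[lam2]_(t in D) ((normc (u (mulmxv A t))) ^+ n)%:E)%E.
Proof.
move=> uA n0 mR mI; rewrite torus_norm_pow//.
have mu : measurable_fun [set: plane] (fun x => ((normc (u x)) ^+ n)%:E).
  apply/measurable_EFinP; apply: measurable_funX; exact: measurable_normc.
rewrite (ge0_integral_scales_area (normr_ge0 _) (scales_area_mulmxv uA)
  (measurable_fundamental_domain uA) mu).
  by rewrite preimage_fundamental_domain.
by move=> x; rewrite lee_fin exprn_ge0// normc_ge0.
Qed.

(** For v = u \o A these are the coefficients of u up to the factor
    sqrt |det A|, indexed by integer frequencies. *)
Definition square_coef (v : R * R -> R[i]) (k : int * int) : R[i] :=
  cintegral D (fun t => v t * conjc (character k t)).

Definition integrable_on_square (v : plane -> R[i]) :=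
  lam2.-integrable D (fun t => (Re (v t))%:E) /\
  lam2.-integrable D (fun t => (Im (v t))%:E).

Lemma bounded_Re_char k : bounded_measurable (fun t => Re (character k t) : R).
Proof.
have := bounded_measurable_wave (R := R) k 0; congr bounded_measurable.
by apply/funext => t; rewrite /wave addr0.
Qed.

Lemma bounded_Im_char k : bounded_measurable (fun t => Im (character k t) : R).
Proof.
have := bounded_measurable_wave (R := R) k (- (pi / 2)); congr bounded_measurable.
by apply/funext => t; rewrite /wave cosBpihalf.
Qed.

Lemma Re_mulJ (x y : R[i]) : Re (x * conjc y) = Re x * Re y + Im x * Im y.
Proof. by case: x y => [a b] [c d] /=; ring. Qed.

Lemma Im_mulJ (x y : R[i]) : Im (x * conjc y) = Im x * Re y - Re x * Im y.
Proof. by case: x y => [a b] [c d] /=; ring. Qed.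

Lemma integrable_on_square_char v k : integrable_on_square v ->
  integrable_on_square (fun t => v t * conjc (character k t)).
Proof.
move=> [iR iI]; have mD := @measurable_unit_square R.
have iRR := integrable_mul_bounded iR (bounded_Re_char k).
have iRI := integrable_mul_bounded iR (bounded_Im_char k).
have iIR := integrable_mul_bounded iI (bounded_Re_char k).
have iII := integrable_mul_bounded iI (bounded_Im_char k).
split.
- under eq_fun do rewrite Re_mulJ; exact: (integrableD mD iRR iII).
- under eq_fun do rewrite Im_mulJ; exact: (integrableB mD iIR iRI).
Qed.

(** A real number x satisfies |x| <= 1 + x^2, and the square has finite measure. *)
Lemma L2_integrable_on_square (A : 'M[R]_2) u : A \in unitmx -> L2_torus A u ->
  integrable_on_square (fun t => u (mulmxv A t)).
Proof.
move=> uA Lu; have [_ mR mI fin] := Lu.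
have mD := @measurable_unit_square R.
have mR' : measurable_fun [set: plane] (fun t => Re (u (mulmxv A t))).
  exact: (measurableT_comp mR (measurable_mulmxv A)).
have mI' : measurable_fun [set: plane] (fun t => Im (u (mulmxv A t))).
  exact: (measurableT_comp mI (measurable_mulmxv A)).
have d0 : 0 < `|\det A| by rewrite normr_gt0 -unitfE -unitmxE.
have i2 : lam2.-integrable D (fun t => (normc (u (mulmxv A t)) ^+ 2)%:E).
  apply/integrableP; split.
    apply: measurable_funTS; apply/measurable_EFinP; apply: measurable_funX.
    exact: measurable_normc.
  under eq_integral => x _ do rewrite gee0_abs ?lee_fin ?exprn_ge0 ?normc_ge0//.
  have : (torus_norm A 2 u ^+ 2 < +oo)%E.
    by rewrite expe2 lte_mul_pinfty// ?Lnorm_ge0// ge0_fin_numE ?Lnorm_ge0.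
  rewrite (torus_norm_transport uA _ mR mI)// => fin2.
  rewrite ltNge leye_eq; apply/negP => /eqP h; move: fin2; rewrite h.
  by rewrite gt0_muley ?lte_fin// ltxx.
have i1 : lam2.-integrable D (EFin \o cst (1 : R)).
  by apply: (bounded_integrable_square (C := 1)) => // t; rewrite normr1.
have i12 := integrableD mD i1 i2.
have bnd z : `|Re z| <= 1 + normc z ^+ 2 /\ `|Im z| <= 1 + normc z ^+ 2 :> R.
  rewrite normc_sqrE -[Re z ^+ 2]real_normK ?num_real// -[Im z ^+ 2]real_normK ?num_real//.
  have := sqr_ge0 (`|Re z| - 1); have := sqr_ge0 (`|Im z| - 1).
  have := normr_ge0 (Re z); have := normr_ge0 (Im z).
  by rewrite !sqrrB; split; nra.
have pos z : 0 <= 1 + normc z ^+ 2 :> R by rewrite addr_ge0// sqr_ge0.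
split.
- apply: (le_integrable mD _ _ i12).
    by apply: measurable_funTS; exact/measurable_EFinP.
  by move=> t _ /=; rewrite lee_fin [leRHS]ger0_norm ?pos//; exact: (bnd _).1.
- apply: (le_integrable mD _ _ i12).
    by apply: measurable_funTS; exact/measurable_EFinP.
  by move=> t _ /=; rewrite lee_fin [leRHS]ger0_norm ?pos//; exact: (bnd _).2.
Qed.

(** The dual lattice is designed for this: the scalar product of A^-T k with A t is
    that of k with t, so characters pull back to characters. *)
Lemma fourier_coef_transport (A : 'M[R]_2) u k : A \in unitmx -> L2_torus A u ->
  fourier_coef A u (mulmxv (invmx A)^T (freq k)) =
  (Num.sqrt `|\det A|)%:C%C * square_coef (fun t => u (mulmxv A t)) k.
Proof.
move=> uA Lu; have [_ mR mI fin] := Lu.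
set m := mulmxv _ _; set q := Num.sqrt `|\det A|.
have mD := @measurable_unit_square R.
have d0 : 0 < `|\det A| by rewrite normr_gt0 -unitfE -unitmxE.
have qE : `|\det A| = q * q by rewrite -expr2 sqr_sqrtr// ltW.
have q0 : q != 0 by rewrite gt_eqF// sqrtr_gt0.
have [iR iI] := integrable_on_square_char k (L2_integrable_on_square uA Lu).
have basisE t : fourier_basis A m (mulmxv A t) = (q^-1)%:C%C * character k t.
  by rewrite /fourier_basis /character /m dotv_tr mulmxvK.
have mC : measurable_fun [set: plane] (fun x : plane => cos (2 * pi * dotv m x)).
  apply: (measurableT_comp measurable_cosT); apply: measurable_funM => //.
  by apply: measurable_funD; exact: measurable_funM.
have mS : measurable_fun [set: plane] (fun x : plane => sin (2 * pi * dotv m x)).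
  apply: (@measurableT_comp _ _ _ _ _ _ (@sin R)).
    by apply: continuous_measurable_fun; exact: continuous_sin.
  apply: measurable_funM => //.
  by apply: measurable_funD; exact: measurable_funM.
rewrite /fourier_coef /square_coef /cintegral.
have sa := scales_area_mulmxv uA.
have mF := measurable_fundamental_domain uA.
have pE := preimage_fundamental_domain uA.
rewrite (Rintegral_scales_area (normr_ge0 _) sa mF); last 2 first.
- under eq_fun do rewrite Re_mulJ /fourier_basis /expi /= !mul0r subr0 addr0.
  by apply: measurable_funD; apply: measurable_funM => //; exact: measurable_funM.
- rewrite pE.
  have := integrableZl mD q^-1 iR; congr (_.-integrable _ _); apply/funext => t.
  rewrite -[RHS]/((Re (u (mulmxv A t) *
    conjc (fourier_basis A m (mulmxv A t))))%:E) basisE.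
  by case: (u _) (character k t) => [a b] [c d] /=; congr EFin; ring.
rewrite (Rintegral_scales_area (normr_ge0 _) sa mF); last 2 first.
- under eq_fun do rewrite Im_mulJ /fourier_basis /expi /= !mul0r subr0 addr0.
  by apply: measurable_funB; apply: measurable_funM => //; exact: measurable_funM.
- rewrite pE.
  have := integrableZl mD q^-1 iI; congr (_.-integrable _ _); apply/funext => t.
  rewrite -[RHS]/((Im (u (mulmxv A t) *
    conjc (fourier_basis A m (mulmxv A t))))%:E) basisE.
  by case: (u _) (character k t) => [a b] [c d] /=; congr EFin; ring.
rewrite pE.
rewrite (@eq_Rintegral _ _ _ _ _ (fun t : plane =>
   q^-1 * Re (u (mulmxv A t) * conjc (character k t)))); last first.
  by move=> t _; rewrite basisE; case: (u _) (character k t) => [a b] [c d] /=; ring.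
rewrite [X in Complex _ (_ * X)](@eq_Rintegral _ _ _ _ _ (fun t : plane =>
   q^-1 * Im (u (mulmxv A t) * conjc (character k t)))); last first.
  by move=> t _; rewrite basisE; case: (u _) (character k t) => [a b] [c d] /=; ring.
rewrite !RintegralZl// qE !mulrA mulfK//.
by apply/eqP; rewrite eq_complex /= !mul0r subr0 addr0 !eqxx.
Qed.

End TorusTransport.

(** * Functions with finitely many nonzero coefficients *)

Section Decomposition.
Context {R : realType}.
Local Notation plane := (measurableTypeR R * measurableTypeR R)%type.
Local Notation lam2 := (@lebesgue_measure2 R).
Local Notation D := (@unit_square R).
Local Notation normc := ComplexField.Normc.normc.
Local Notation Re := complex.Re.
Local Notation Im := complex.Im.

Lemma wave_split (k : int * int) (th : R) t :
  wave k th t = cos th * Re (character k t) - sin th * Im (character k t).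
Proof. by rewrite /wave cosD /= mulrC [sin th * _]mulrC. Qed.

(** The coefficients at k and - k together give the integrals of Re w and of Im w
    against the cosine and the sine of frequency k, so uniqueness for real
    functions applies to both parts. *)
Lemma square_uniqueness (w : plane -> R[i]) : integrable_on_square w ->
  (forall k, square_coef w k = 0) ->
  ae_eq lam2 D (fun t => (Re (w t))%:E) (cst 0%E) /\
  ae_eq lam2 D (fun t => (Im (w t))%:E) (cst 0%E).
Proof.
move=> [iR iI] w0; have mD := @measurable_unit_square R.
have iRR k := integrable_mul_bounded iR (bounded_Re_char k).
have iRI k := integrable_mul_bounded iR (bounded_Im_char k).
have iIR k := integrable_mul_bounded iI (bounded_Re_char k).
have iII k := integrable_mul_bounded iI (bounded_Im_char k).
have coefE k :
    \int[lam2]_(t in D) (Re (w t) * Re (character k t)) +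
    \int[lam2]_(t in D) (Im (w t) * Im (character k t)) = 0 /\
    \int[lam2]_(t in D) (Im (w t) * Re (character k t)) -
    \int[lam2]_(t in D) (Re (w t) * Im (character k t)) = 0.
  rewrite -RintegralD// -RintegralB//.
  have h1 := congr1 (@complex.Re R) (w0 k); have h2 := congr1 (@complex.Im R) (w0 k).
  split; [rewrite -[RHS]h1|rewrite -[RHS]h2]; apply: eq_Rintegral => t _.
    by rewrite Re_mulJ.
  by rewrite Im_mulJ.
have ReN k t : Re (character (- k) t) = Re (character k t) :> R.
  by rewrite characterN; case: character.
have ImN k t : Im (character (- k) t) = - Im (character k t) :> R.
  by rewrite characterN; case: character.
have intN (f h : plane -> R) : (forall t, f t = - h t) ->
    lam2.-integrable D (EFin \o h) ->
    \int[lam2]_(t in D) f t = - \int[lam2]_(t in D) h t.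
  move=> fh ih; rewrite -mulN1r -RintegralZl//.
  by apply: eq_Rintegral => t _; rewrite fh mulN1r.
have coefs k : [/\ \int[lam2]_(t in D) (Re (w t) * Re (character k t)) = 0,
    \int[lam2]_(t in D) (Im (w t) * Im (character k t)) = 0,
    \int[lam2]_(t in D) (Im (w t) * Re (character k t)) = 0 &
    \int[lam2]_(t in D) (Re (w t) * Im (character k t)) = 0].
  have [e1 e2] := coefE k; have [] := coefE (- k).
  rewrite (@intN (fun t : plane => Im (w t) * Im (character (- k) t))
    (fun t : plane => Im (w t) * Im (character k t)))//; last first.
    by move=> t; rewrite ImN mulrN.
  rewrite (@intN (fun t : plane => Re (w t) * Im (character (- k) t))
    (fun t : plane => Re (w t) * Im (character k t)))//; last first.
    by move=> t; rewrite ImN mulrN.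
  have rR : \int[lam2]_(t in D) (Re (w t) * Re (character (- k) t)) =
      \int[lam2]_(t in D) (Re (w t) * Re (character k t)).
    by apply: eq_Rintegral => t _; rewrite ReN.
  have rI : \int[lam2]_(t in D) (Im (w t) * Re (character (- k) t)) =
      \int[lam2]_(t in D) (Im (w t) * Re (character k t)).
    by apply: eq_Rintegral => t _; rewrite ReN.
  rewrite rR rI.
  by move=> e3 e4; split; lra.
split.
- apply: fourier_uniqueness => // k th.
  rewrite (@eq_Rintegral _ _ _ _ _ (fun t : plane =>
     cos th * (Re (w t) * Re (character k t)) -
     sin th * (Re (w t) * Im (character k t)))); last first.
    by move=> t _; rewrite wave_split; ring.
  have [c1 _ _ c2] := coefs k.
  rewrite RintegralB//;
    [|exact: (integrableZl mD _ (iRR k))|exact: (integrableZl mD _ (iRI k))].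
  by rewrite !RintegralZl// c1 c2 !mulr0 subr0.
- apply: fourier_uniqueness => // k th.
  rewrite (@eq_Rintegral _ _ _ _ _ (fun t : plane =>
     cos th * (Im (w t) * Re (character k t)) -
     sin th * (Im (w t) * Im (character k t)))); last first.
    by move=> t _; rewrite wave_split; ring.
  have [_ c1 c2 _] := coefs k.
  rewrite RintegralB//;
    [|exact: (integrableZl mD _ (iIR k))|exact: (integrableZl mD _ (iII k))].
  by rewrite !RintegralZl// c1 c2 !mulr0 subr0.
Qed.

Lemma integrable_on_square_trig_sum (I : Type) (r : seq I) d f :
  integrable_on_square (trig_sum (R := R) r d f).
Proof.
split.
- exact: (bounded_integrable (bounded_Re_trig_sum _ _ _)).
- exact: (bounded_integrable (bounded_Im_trig_sum _ _ _)).
Qed.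

Lemma integrable_on_squareB (v w : plane -> R[i]) :
  integrable_on_square v -> integrable_on_square w ->
  integrable_on_square (fun t => v t - w t).
Proof.
move=> [vR vI] [wR wI]; have mD := @measurable_unit_square R; split.
- have := integrableB mD vR wR; congr (_.-integrable _ _); apply/funext => t.
  by rewrite -EFinB /=; case: (v t) (w t) => [a b] [c d].
- have := integrableB mD vI wI; congr (_.-integrable _ _); apply/funext => t.
  by rewrite -EFinB /=; case: (v t) (w t) => [a b] [c d].
Qed.

Lemma square_coefB (v w : plane -> R[i]) k :
  integrable_on_square v -> integrable_on_square w ->
  square_coef (fun t => v t - w t) k = square_coef v k - square_coef w k.
Proof.
move=> /(integrable_on_square_char k) [vR vI] /(integrable_on_square_char k) [wR wI].
have mD := @measurable_unit_square R.
rewrite /square_coef /cintegral; apply/eqP; rewrite eq_complex /=.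
by apply/andP; split; apply/eqP; rewrite -RintegralB//; apply: eq_Rintegral => t _;
  rewrite mulrBl; case: (v t * _) (w t * _) => [a b] [c d].
Qed.

Lemma square_coef_trig_sum (s : seq (int * int)) (c : int * int -> R[i]) k :
  uniq s -> square_coef (trig_sum s c id) k = if k \in s then c k else 0.
Proof.
move=> us; rewrite /square_coef.
rewrite (_ : (fun t => _) = trig_sum s c (fun l => l - k)).
  rewrite cintegral_trig_sum; under eq_bigl do rewrite subr_eq0.
  case: ifP => ks; last first.
    rewrite big_seq_cond big1// => l /andP[ls /eqP lk]; by rewrite lk ks in ls.
  by rewrite -big_filter filter_pred1_uniq// big_seq1.
apply/funext => t; rewrite /trig_sum mulr_suml; apply: eq_bigr => l _.
by rewrite characterD characterN mulrA.
Qed.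

(** All the coefficients of the difference vanish. *)
Lemma trig_sum_of_coef (s : seq (int * int)) (v : plane -> R[i]) :
  integrable_on_square v -> uniq s -> (forall k, k \notin s -> square_coef v k = 0) ->
  ae_eq lam2 D (fun t => (normc (v t))%:E)
    (fun t => (normc (trig_sum s (square_coef v) id t))%:E).
Proof.
move=> iv us vs.
have iP := integrable_on_square_trig_sum s (square_coef v) id.
have [|aeR aeI] := square_uniqueness (integrable_on_squareB iv iP).
  move=> k; rewrite square_coefB// square_coef_trig_sum//.
  by case: ifPn => [_|/vs ->]; rewrite subrr.
near=> t.
move=> Dt.
have hR : (Re (v t - trig_sum s (square_coef v) id t))%:E = 0%E.
  by move: Dt; near: t; exact: aeR.
have hI : (Im (v t - trig_sum s (square_coef v) id t))%:E = 0%E.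
  by move: Dt; near: t; exact: aeI.
congr ((normc _)%:E); apply/eqP; rewrite -subr_eq0 eq_complex.
by move: hR hI => [->] [->]; rewrite !eqxx.
Unshelve. all: by end_near.
Qed.

Lemma integrable_norm_trig_sum (s : seq (int * int)) (c : int * int -> R[i]) n :
  lam2.-integrable D (fun t => (normc (trig_sum s c id t) ^+ n)%:E).
Proof.
set P := trig_sum _ _ _.
have [mPR [CR PR]] := bounded_Re_trig_sum s c id.
have [mPI [CI PI]] := bounded_Im_trig_sum s c id.
apply: (bounded_integrable_square (C := (1 + CR ^+ 2 + CI ^+ 2) ^+ n)) => [|t].
  by apply: measurable_funX; exact: measurable_normc.
rewrite ger0_norm ?exprn_ge0 ?normc_ge0//.
have h : normc (P t) ^+ 2 <= CR ^+ 2 + CI ^+ 2.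
  rewrite normc_sqrE lerD//.
    by rewrite -real_normK ?num_real// lerXn2r ?nnegrE ?(le_trans _ (PR t)) ?PR.
  by rewrite -real_normK ?num_real// lerXn2r ?nnegrE ?(le_trans _ (PI t)) ?PI.
apply: lerXn2r; rewrite ?nnegrE ?normc_ge0//.
  by rewrite !addr_ge0// sqr_ge0.
have := sqr_ge0 (normc (P t) - 1); have := normc_ge0 (P t); nra.
Qed.

Lemma integral_norm_trig_sum (s : seq (int * int)) (c : int * int -> R[i]) n :
  (\int[lam2]_(t in D) (normc (trig_sum s c id t) ^+ n)%:E =
   (\int[lam2]_(t in D) (normc (trig_sum s c id t) ^+ n)%R)%:E)%E.
Proof.
rewrite /Rintegral fineK//; apply: integrable_fin_num.
  exact: measurable_unit_square.
exact: integrable_norm_trig_sum.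
Qed.

Lemma integral_norm_of_coef (s : seq (int * int)) (v : plane -> R[i]) n :
  measurable_fun [set: plane] (fun t => Re (v t)) ->
  measurable_fun [set: plane] (fun t => Im (v t)) ->
  integrable_on_square v -> uniq s -> (forall k, k \notin s -> square_coef v k = 0) ->
  (\int[lam2]_(t in D) ((normc (v t)) ^+ n)%:E =
   (\int[lam2]_(t in D) (normc (trig_sum s (square_coef v) id t) ^+ n)%R)%:E)%E.
Proof.
move=> mR mI iv us vs; rewrite -integral_norm_trig_sum.
have mD := @measurable_unit_square R.
apply: ge0_ae_eq_integral => //.
- apply: measurable_funTS; apply/measurable_EFinP; apply: measurable_funX.
  exact: measurable_normc.
- by case/integrableP: (integrable_norm_trig_sum s (square_coef v) n).
- by move=> t _; rewrite lee_fin exprn_ge0// normc_ge0.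
- by move=> t _; rewrite lee_fin exprn_ge0// normc_ge0.
have := trig_sum_of_coef iv us vs; apply: filterS => t /= h Dt.
by have [->] := h Dt.
Qed.

Lemma Re_sum (I : Type) (r : seq I) (P : pred I) (F : I -> R[i]) :
  Re (\sum_(i <- r | P i) F i) = \sum_(i <- r | P i) Re (F i).
Proof. by apply: (big_morph (@complex.Re R) (@ReD R)). Qed.

Lemma norm2_trig_sum (s : seq (int * int)) (c : int * int -> R[i]) : uniq s ->
  \int[lam2]_(t in D) normc (trig_sum s c id t) ^+ 2 = \sum_(k <- s) normc (c k) ^+ 2.
Proof.
move=> us; rewrite parseval Re_sum; apply: eq_big_seq => k ks.
under eq_bigl do rewrite eq_sym.
by rewrite normc_sqr -big_filter filter_pred1_uniq// big_seq1.
Qed.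

Lemma norm4_trig_sum (s : seq (int * int)) (c : int * int -> R[i]) :
  \int[lam2]_(t in D) normc (trig_sum s c id t) ^+ 4 =
  \sum_(a <- s) \sum_(b <- s) \sum_(k <- s) \sum_(l <- s)
    (a + b == k + l)%:R * Re (c a * c b * conjc (c k * c l)).
Proof.
rewrite (@eq_Rintegral _ _ _ _ _ (fun t : plane =>
  normc (trig_sum [seq (i, j) | i <- s, j <- s] (fun p => c p.1 * c p.2)
    (fun p => p.1 + p.2) t) ^+ 2)); last first.
  by move=> t _; rewrite normc_trig_sum_exp4.
rewrite parseval big_allpairs !Re_sum; apply: eq_bigr => a _.
rewrite Re_sum; apply: eq_bigr => b _.
rewrite big_mkcond big_allpairs Re_sum; apply: eq_bigr => k _.
rewrite Re_sum; apply: eq_bigr => l _ /=.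
by case: ifP => _; rewrite ?mul1r ?mul0r.
Qed.

Lemma norm4_trig_sum_le (s : seq (int * int)) (c : int * int -> R[i]) :
  \int[lam2]_(t in D) normc (trig_sum s c id t) ^+ 4 <= energy s (fun k => normc (c k)).
Proof.
rewrite norm4_trig_sum; apply: ler_sum4 => a b k l _ _ _ _.
rewrite ler_wpM2l//; apply: le_trans (Re_le_normc _) _.
by rewrite !ComplexField.Normc.normcM normc_conj ComplexField.Normc.normcM.
Qed.

Lemma norm4_trig_sum_cst (s : seq (int * int)) (x : R) :
  \int[lam2]_(t in D) normc (trig_sum s (fun=> x%:C%C) id t) ^+ 4 =
  x ^+ 4 * energy s (fun=> 1).
Proof.
rewrite norm4_trig_sum /energy mulr_sumr; apply: eq_bigr => a _.
rewrite mulr_sumr; apply: eq_bigr => b _; rewrite mulr_sumr; apply: eq_bigr => k _.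
rewrite mulr_sumr; apply: eq_bigr => l _ /=; rewrite mulrCA; congr (_ * _); ring.
Qed.

End Decomposition.

(** * Lattice points on a circle *)

Section Circle.
Context {R : realType}.

(** By Lagrange's identity the determinant of two orthogonal nonzero vectors is not
    0, so they span the plane. *)
Lemma orthogonal_pair (w s z : R * R) : dotv w s = 0 -> dotv z w = 0 -> dotv z s = 0 ->
  w != 0 -> s != 0 -> z = 0.
Proof.
have sq0 (x : R * R) : x != 0 -> dotv x x != 0.
  case: x => x y; apply: contraNneq; rewrite /dotv /= => h.
  have x0 : x = 0 by nra.
  have y0 : y = 0 by nra.
  by rewrite x0 y0.
move=> ws zw zs /sq0 w0 /sq0 s0.
have det2 : (w.1 * s.2 - w.2 * s.1) ^+ 2 = dotv w w * dotv s s.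
  have : (w.1 * s.2 - w.2 * s.1) ^+ 2 + dotv w s ^+ 2 = dotv w w * dotv s s.
    by rewrite /dotv; ring.
  by rewrite ws expr0n addr0.
have det0 : w.1 * s.2 - w.2 * s.1 != 0.
  by rewrite -sqrf_eq0 det2 mulf_neq0.
case: z zw zs => z1 z2; rewrite /dotv /= => zw zs.
congr pair; apply: (mulIf det0); rewrite mul0r.
  transitivity ((z1 * w.1 + z2 * w.2) * s.2 - (z1 * s.1 + z2 * s.2) * w.2); first by ring.
  by rewrite zw zs; ring.
transitivity ((z1 * s.1 + z2 * s.2) * w.1 - (z1 * w.1 + z2 * w.2) * s.1); first by ring.
by rewrite zw zs; ring.
Qed.

Lemma enorm_sqr (x : R * R) : enorm x ^+ 2 = dotv x x.
Proof. by rewrite /enorm sqr_sqrtr ?addr_ge0 ?sqr_ge0// /dotv -!expr2. Qed.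

Lemma freq_inj : injective (@freq R).
Proof. by move=> [a b] [c d] [/intr_inj -> /intr_inj ->]. Qed.

Lemma dotvC (x y : R * R) : dotv x y = dotv y x.
Proof. by rewrite /dotv; ring. Qed.

Lemma dotvDr (x y z : R * R) : dotv x (y + z) = dotv x y + dotv x z.
Proof. by rewrite dotvC dotvDl !(dotvC x). Qed.

Lemma dotvNr (x y : R * R) : dotv x (- y) = - dotv x y.
Proof. by rewrite dotvC dotvNl dotvC. Qed.

(** A parallelogram inscribed in a circle is a rectangle.  In terms of vectors,
    equality of the norms makes a - c, a + b and c - b pairwise orthogonal, and
    the plane does not have room for three such nonzero vectors. *)
Lemma equal_norm_sums (a b c d : R * R) : dotv a a = dotv b b -> dotv a a = dotv c c ->
  dotv a a = dotv d d -> a + b = c + d ->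
  [\/ a = c, a + b = 0 | c = b].
Proof.
move=> hb hc hd e.
have [|w0] := eqVneq (a - c) 0; first by move/eqP; rewrite subr_eq0 => /eqP; constructor 1.
have [|s0] := eqVneq (a + b) 0; first by constructor 2.
constructor 3; have dE : d = a + b - c by rewrite e addrC addKr.
move: hd; rewrite dE !(dotvDl, dotvDr, dotvNl, dotvNr) => hd.
have : c - b = 0.
  apply: (@orthogonal_pair (a - c) (a + b)) => //;
    rewrite !(dotvDl, dotvDr, dotvNl, dotvNr);
    have := dotvC a b; have := dotvC a c; have := dotvC b c; lra.
by move/eqP; rewrite subr_eq0 => /eqP.
Qed.

Lemma circle_trivial_sums (M : 'M[R]_2) (la : R) (s : seq (int * int)) : M \in unitmx ->
  (forall k, k \in s -> enorm (mulmxv M (freq k)) ^+ 2 = la) -> trivial_sums s.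
Proof.
move=> uM sla a b c d /sla + /sla + /sla + /sla.
pose phi k := mulmxv M (freq k).
have phiD k l : phi (k + l) = phi k + phi l by rewrite /phi freqD mulmxvD.
have phi_inj : injective phi.
  move=> k l h; apply: freq_inj.
  by rewrite -[LHS](mulmxvK _ uM) -[RHS](mulmxvK _ uM) -/(phi k) h.
have phi0 : phi 0 = 0 by apply: (addrI (phi 0)); rewrite -phiD !addr0.
rewrite -!/(phi _) !enorm_sqr => ha hb hc hd e.
have [] := @equal_norm_sums (phi a) (phi b) (phi c) (phi d);
  rewrite ?ha ?hb ?hc ?hd -?phiD ?e//.
- move=> /phi_inj ac; constructor 1; split => //.
  by apply: (addrI a); rewrite e ac.
- rewrite -phi0 => /phi_inj cd; constructor 3; split; apply/eqP.
    by rewrite -addr_eq0 addrC e cd.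
  by rewrite -addr_eq0 addrC cd.
- move=> /phi_inj cb; constructor 2; split => //.
  by apply: (addrI c); rewrite -e cb addrC.
Qed.

(** The coordinates of the frequency k are bounded in terms of the point M k of the
    circle, so k ranges over a finite box. *)
Lemma finite_circle (M : 'M[R]_2) (la : R) : M \in unitmx ->
  exists s : seq (int * int), uniq s /\
    forall k, (k \in s) = (enorm (mulmxv M (freq k)) ^+ 2 == la).
Proof.
move=> uM; set B := invmx M.
pose C := (`|B 0 0| + `|B 0 1| + `|B 1 0| + `|B 1 1|) * (1 + `|la|).
have C0 : 0 <= C by rewrite /C mulr_ge0 ?addr_ge0.
have [box boxP] : exists box : seq int, forall n : int,
    `|n%:~R| <= C :> R -> n \in box.
  pose N := Num.bound C.
  exists [seq n%:Z - N%:Z | n <- iota 0 (2 * N).+1] => n nC.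
  have : `|n%:~R| < N%:R :> R by exact: le_lt_trans nC (archi_boundP C0).
  rewrite -intr_norm -[N%:R]/(N%:Z%:~R) ltr_int => nN.
  by apply/mapP; exists `|(n + N%:Z)%R|%N; [rewrite mem_iota; lia|lia].
exists (undup [seq k <- [seq (i, j) | i <- box, j <- box] |
    enorm (mulmxv M (freq k)) ^+ 2 == la]).
split; first exact: undup_uniq.
move=> k; rewrite mem_undup mem_filter.
have [kla|//] := eqVneq (enorm (mulmxv M (freq k)) ^+ 2) la; rewrite ?eqxx//=.
have kE : freq k = mulmxv B (mulmxv M (freq k)) by rewrite mulmxvK.
move: kla kE; rewrite enorm_sqr; case: (mulmxv M (freq k)) => x y; rewrite /dotv /= => xy.
have sq z : z ^+ 2 <= la -> `|z| <= 1 + `|la|.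
  move=> zla; have := ler_norm la; have := normr_ge0 z; rewrite -real_normK ?num_real// in zla.
  have := sqr_ge0 (`|z| - 1); nra.
have xle : `|x| <= 1 + `|la| by apply: sq; have := sqr_ge0 y; nra.
have yle : `|y| <= 1 + `|la| by apply: sq; have := sqr_ge0 x; nra.
case: k => k1 k2 [k1E k2E].
have bnd p q : `|p * x + q * y| <= (`|p| + `|q|) * (1 + `|la|).
  by apply: le_trans (ler_normD _ _) _; rewrite !normrM mulrDl lerD// ler_wpM2l.
have := normr_ge0 (B 0 0); have := normr_ge0 (B 0 1).
have := normr_ge0 (B 1 0); have := normr_ge0 (B 1 1) => n1 n2 n3 n4.
have la0 := normr_ge0 la.
apply/allpairsPdep; exists k1, k2; split => //; apply: boxP => /=.
  by rewrite k1E; apply: le_trans (bnd _ _) _; rewrite /C ler_wpM2r//; lra.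
by rewrite k2E; apply: le_trans (bnd _ _) _; rewrite /C ler_wpM2r//; lra.
Qed.

End Circle.

(** * The upper bound *)

Section Main.
Context {R : realType}.
Local Notation plane := (measurableTypeR R * measurableTypeR R)%type.
Local Notation lam2 := (@lebesgue_measure2 R).
Local Notation D := (@unit_square R).
Local Notation normc := ComplexField.Normc.normc.

Lemma expe4 (x : \bar R) : (x ^+ 4 = (x ^+ 2) ^+ 2)%E.
Proof. by rewrite !expeS !expe0 !mule1 !muleA. Qed.

(** The composite of u with A is almost everywhere a trigonometric sum over the
    finite set s of integer frequencies that A^-T sends to the circle. *)
Lemma L4_upper_bound (A : 'M[R]_2) (lambda : R) (u : R * R -> R[i]) :
  A \in unitmx -> L2_torus A u -> fourier_supp A u `<=` circle A lambda ->
  (torus_norm A 4 u ^+ 4 <= (3 / `|\det A|)%:E * torus_norm A 2 u ^+ 4)%E.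
Proof.
move=> uA Lu suppu; have [_ mR mI _] := Lu.
have d0 : 0 < `|\det A| by rewrite normr_gt0 -unitfE -unitmxE.
pose M := (invmx A)^T.
have uM : M \in unitmx by rewrite /M unitmx_tr unitmx_inv.
have [s [us sP]] := finite_circle lambda uM.
pose v t := u (mulmxv A t).
have vs k : k \notin s -> square_coef v k = 0.
  move=> ks; apply/eqP; apply: contraNT ks => v0; rewrite sP; apply/eqP.
  have [] // := suppu (mulmxv M (freq k)).
  split; first by exists k.
  rewrite (fourier_coef_transport _ uA Lu) mulf_neq0//.
  by rewrite eq_complex /= eqxx andbT gt_eqF// sqrtr_gt0.
have mvR : measurable_fun [set: plane] (fun t => complex.Re (v t)).
  exact: (measurableT_comp mR (measurable_mulmxv A)).
have mvI : measurable_fun [set: plane] (fun t => complex.Im (v t)).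
  exact: (measurableT_comp mI (measurable_mulmxv A)).
have iv := L2_integrable_on_square uA Lu.
rewrite [X in (_ <= _ * X)%E]expe4.
rewrite (torus_norm_transport uA _ mR mI)// (torus_norm_transport uA _ mR mI)//.
rewrite !(integral_norm_of_coef _ mvR mvI iv us vs).
rewrite expe2 -!EFinM lee_fin norm2_trig_sum//.
set S := \sum_(k <- s) _.
have le4 := le_trans (norm4_trig_sum_le s (square_coef v))
  (energy_le us (circle_trivial_sums uM (la := lambda) _) (fun k => normc_ge0 _)).
have -> : 3 / `|\det A| * (`|\det A| * S * (`|\det A| * S)) = `|\det A| * (3 * S ^+ 2).
  by field; rewrite gt_eqF.
by rewrite ler_wpM2l// le4// => k; rewrite sP => /eqP.
Qed.

(** * Sharpness *)

Lemma character_periodic (k l : int * int) (x : R * R) :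
  character k (x + freq l) = character k x.
Proof.
rewrite /character.
have -> : 2 * pi * dotv (freq k) (x + freq l) =
    2 * pi * dotv (freq k) x + 2 * pi * (k.1 * l.1 + k.2 * l.2)%:~R.
  by rewrite dotvDr mulrDr {3}/dotv /freq /= intrD !intrM.
by rewrite /expi cosD2pin sinD2pin.
Qed.

Section Extremizer.
Variables (la : nat) (s : seq (int * int)).
Hypotheses (us : uniq s) (s0 : (0 < size s)%N)
  (sla : forall k, k \in s -> k.1 ^+ 2 + k.2 ^+ 2 = la%:Z)
  (sN : forall k, k \in s -> - k \in s).

(** Equal weights make [energy_le] asymptotically sharp on large symmetric sets. *)
Definition extremizer : R * R -> R[i] :=
  trig_sum s (fun=> (Num.sqrt (size s)%:R)^-1%:C%C) id.

Let u1 : (1%:M : 'M[R]_2) \in unitmx. Proof. exact: unitmx1. Qed.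
Let N0 : 0 < (size s)%:R :> R. Proof. by rewrite ltr0n. Qed.

Lemma measurable_Re_extremizer :
  measurable_fun [set: plane] (fun t => complex.Re (extremizer t)).
Proof. by have [] := bounded_Re_trig_sum s (fun=> (Num.sqrt (size s)%:R)^-1%:C%C : R[i]) id. Qed.

Lemma measurable_Im_extremizer :
  measurable_fun [set: plane] (fun t => complex.Im (extremizer t)).
Proof. by have [] := bounded_Im_trig_sum s (fun=> (Num.sqrt (size s)%:R)^-1%:C%C : R[i]) id. Qed.

Lemma torus_norm_extremizer n : (0 < n)%N ->
  (torus_norm 1%:M n%:R extremizer ^+ n =
   (\int[lam2]_(t in D) (normc (extremizer t) ^+ n)%R)%:E)%E.
Proof.
move=> n0; rewrite (torus_norm_transport u1 n0 measurable_Re_extremizer measurable_Im_extremizer).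
rewrite det1 normr1 mul1e -integral_norm_trig_sum.
by apply: eq_integral => t _; rewrite mulmxv1.
Qed.

Lemma norm2_extremizer : (torus_norm 1%:M 2 extremizer ^+ 2 = 1)%E.
Proof.
rewrite torus_norm_extremizer// norm2_trig_sum//.
rewrite big_const_seq count_predT iter_addr addr0.
rewrite normc_sqrE /= expr0n /= addr0 exprVn sqr_sqrtr ?ltW//.
by congr EFin; rewrite -[LHS]mulr_natl mulfV ?gt_eqF.
Qed.

Lemma norm4_extremizer : (torus_norm 1%:M 4 extremizer ^+ 4 =
  (((size s)%:R ^+ 2)^-1 * energy s (fun=> 1))%:E)%E.
Proof.
rewrite torus_norm_extremizer// norm4_trig_sum_cst.
by rewrite exprVn -[4%N]/(2 * 2)%N exprM sqr_sqrtr// ltW.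
Qed.

Lemma L2_extremizer : L2_torus 1%:M extremizer.
Proof.
split; [|exact: measurable_Re_extremizer|exact: measurable_Im_extremizer|].
  move=> x _ [k _ <-]; rewrite mulmxv1; apply: eq_bigr => l _.
  by rewrite (character_periodic l k).
have := norm2_extremizer; rewrite expe2 ltey.
by case: torus_norm => //; rewrite mulyy.
Qed.

Lemma supp_extremizer : fourier_supp 1%:M extremizer `<=` circle 1%:M la%:R.
Proof.
move=> m [lm cm]; split=> //; move: lm cm => [k _ <-].
rewrite (fourier_coef_transport k u1 L2_extremizer).
rewrite (_ : (fun t => _) = extremizer); last by apply/funext => t; rewrite mulmxv1.
rewrite square_coef_trig_sum//; case: ifPn => [ks _|_]; last by rewrite mulr0 eqxx.
rewrite invmx1 trmx1 mulmxv1 enorm_sqr /dotv /= -!intrM -intrD -!expr2 sla//.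
Qed.

Lemma norm4_extremizer_bounds :
  3 - 3 / (size s)%:R <= ((size s)%:R ^+ 2)^-1 * energy s (fun=> 1 : R) <= 3.
Proof.
have rf : trivial_sums s.
  apply: (@circle_trivial_sums R 1%:M la%:R) => // k ks.
  by rewrite mulmxv1 enorm_sqr /dotv /= -!intrM -intrD -!expr2 sla.
have N2 : 0 < (size s)%:R ^+ 2 :> R by rewrite exprn_gt0.
rewrite ler_pdivlMl// ler_pdivrMl//; apply/andP; split.
  apply: le_trans (energy1_ge us rf sN); rewrite le_eqVlt; apply/orP; left; apply/eqP.
  by field; rewrite gt_eqF.
apply: le_trans (energy_le us rf (fun=> ler01)) _.
by rewrite big_const_seq count_predT expr1n iter_addr addr0 mulrC.
Qed.

End Extremizer.

End Main.

(** The rational points ((1 - t^2) / (1 + t^2), 2 t / (1 + t^2)) of the unit circle,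
    for t = 1, ..., n + 1, times the product P of the denominators, together with
    their opposites. *)
Lemma many_lattice_points (n : nat) : exists (la : nat) (s : seq (int * int)),
  [/\ (0 < la)%N, uniq s, size s = (n.+1 + n.+1)%N,
    forall k, k \in s -> k.1 ^+ 2 + k.2 ^+ 2 = la%:Z & forall k, k \in s -> - k \in s].
Proof.
pose w (i : nat) := (1 + i.+1 ^ 2)%N.
pose P := (\prod_(i < n.+1) w i)%N.
have P0 : (0 < P)%N by apply: prodn_gt0 => i.
have qw i : (i < n.+1)%N -> (P %/ w i * w i)%N = P.
  by move=> lin; rewrite divnK// /P (bigD1 (Ordinal lin))//= dvdn_mulr.
pose q i := (P %/ w i)%N.
have q0 i : (i < n.+1)%N -> (0 < q i)%N.
  by move=> /qw; rewrite -/(q i); case: (q i) => // h; move: P0; rewrite -h.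
pose p i : int * int := ((q i)%:Z * (1 - i.+1%:Z ^+ 2), (2 * q i * i.+1)%N%:Z).
(* In this form the first coordinate determines q i, hence i. *)
have pE i : (i < n.+1)%N -> (p i).1 = 2 * (q i)%:Z - P%:Z.
  by move=> /qw h; rewrite /p /= -h -/(q i) /w; nia.
have pinj : {in iota 0 n.+1 &, injective p}.
  move=> i j; rewrite !mem_iota !add0n => /andP[_ li] /andP[_ lj] pij.
  have : (p i).1 = (p j).1 by rewrite pij.
  rewrite !pE// => qij; have {}qij : q i = q j by lia.
  have /eqP : (q i * w i)%N = (q j * w j)%N by rewrite /q !qw.
  rewrite qij.
  by rewrite eqn_pmul2l ?q0// /w eqn_add2l eqn_exp2r// => /eqP [].
(* The points and their opposites are separated by the horizontal axis. *)
have pN i : (i < n.+1)%N -> 0 < (p i).2.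
  by move=> /q0 h; rewrite /p /=; nia.
have pla i : (i < n.+1)%N -> (p i).1 ^+ 2 + (p i).2 ^+ 2 = (P ^ 2)%N%:Z.
  move=> /qw h; rewrite -h -/(q i) /p /w /=; nia.
pose s1 := [seq p i | i <- iota 0 n.+1]; pose s2 := [seq - p i | i <- iota 0 n.+1].
exists (P ^ 2)%N, (s1 ++ s2); split.
- by rewrite expn_gt0 P0.
- rewrite cat_uniq; apply/and3P; split.
  + by rewrite map_inj_in_uniq ?iota_uniq.
  + apply/hasPn => _ /mapP[i + ->]; rewrite mem_iota add0n => /andP[_ li].
    apply/mapP => -[j]; rewrite mem_iota add0n => /andP[_ lj] pij.
    by have := pN i li; have := pN j lj; rewrite -pij [(- _).2]/=; lia.
  + rewrite map_inj_in_uniq ?iota_uniq// => i j si sj /oppr_inj; exact: pinj.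
- by rewrite size_cat !size_map size_iota.
- move=> k; rewrite mem_cat => /orP[] /mapP[i + ->]; rewrite mem_iota add0n => /andP[_ li].
    exact: pla.
  by rewrite /= !sqrrN; exact: pla.
- move=> k; rewrite !mem_cat => /orP[] /mapP[i si ->]; apply/orP; [right|left].
    by apply/mapP; exists i.
  by rewrite opprK; apply/mapP; exists i.
Qed.

Unset Implicit Arguments.

Theorem theorem3p1 (R : realType) :
  (forall A : 'M[R]_2, A \in unitmx ->
   forall lambda : R, 0 < lambda ->
   forall u : R * R -> R[i], L2_torus A u ->
     fourier_supp A u `<=` circle A lambda ->
     (torus_norm A 4 u ^+ 4 <=
        (3 / `|\det A|)%:E * torus_norm A 2 u ^+ 4)%E)
  /\
  exists (lambda_ : nat -> nat) (u_ : nat -> (R * R -> R[i])),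
    [/\ forall n, (0 < lambda_ n)%N,
        forall n, L2_torus 1%:M (u_ n),
        forall n, fourier_supp 1%:M (u_ n) `<=` circle 1%:M (lambda_ n)%:R,
        forall n, (torus_norm 1%:M 2 (u_ n) ^+ 4 = 1)%E &
        (fun n => (torus_norm 1%:M 4 (u_ n) ^+ 4)%E) @ \oo --> (3%:E : \bar R)].
Proof.
split; first by move=> A uA la _ u Lu; exact: L4_upper_bound.
have /choice[la_ /choice[s_ sP]] := many_lattice_points.
have s0 n : (0 < size (s_ n))%N by have [_ _ ->] := sP n.
exists la_, (fun n => extremizer (s_ n)); split=> [n|n|n|n|].
- by have [] := sP n.
- by have [_ us _ _ _] := sP n; exact: L2_extremizer.
- by have [_ us _ sla _] := sP n; exact: supp_extremizer.
- by have [_ us _ _ _] := sP n; rewrite expe4 norm2_extremizer// expe2 mule1.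
have bnd n : 3 - 3 * harmonic n <=
    ((size (s_ n))%:R ^+ 2)^-1 * energy (s_ n) (fun=> 1 : R) <= 3.
  have [_ us sz sla sN] := sP n.
  have /andP[lo ->] := @norm4_extremizer_bounds R _ _ us (s0 n) sla sN.
  rewrite andbT; apply: le_trans lo; rewrite lerB// ler_wpM2l//.
  by rewrite /harmonic /= lef_pV2 ?posrE ?ltr0n// sz ler_nat leq_addr.
under eq_fun => n do rewrite norm4_extremizer//.
apply/fine_cvgP; split; first exact: nearW.
apply: (@squeeze_cvgr _ _ _ _ (fun n => 3 - 3 * harmonic n) (fun=> 3)).
- exact: nearW.
- rewrite -[X in _ --> X]subr0 -[X in _ --> _ - X](mulr0 3).
  apply: cvgB; first exact: cvg_cst.
  by apply: cvgM; [exact: cvg_cst|exact: cvg_harmonic].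
- exact: cvg_cst.
Qed.
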